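(* Let $G$ be an acylindrically hyperbolic group, let $k\ge 1$, and let $w\in\mathbb{F}_k$ be a non-trivial element with $d(w)\neq 1$. Then the verbal subgroup $w(G)$ has infinite width, i.e. $\sup_{g\in w(G)} vl_w(g)=\infty$.
   Context: $\mathbb{F}_k$ is the free group on $x_1,\dots,x_k$. For a group $G$ and $w\in\mathbb{F}_k$, substitution of group elements for the $x_i$ gives a map $w:G^k\to G$. Its image is denoted $w[G]$ (the verbal subset), and $w(G)<G$ is the subgroup generated by $w[G]$ (the verbal subgroup). Let $e_i$ be the sum of the exponents of $x_i$ in $w$. If not all $e_i$ are $0$, $d(w)\ge 1$ is the greatest common divisor of $e_1,\dots,e_k$; if all $e_i=0$, $d(w)=0$. For $g\in w(G)$ the verbal length is $vl_w(g)=\min\{n \mid g=g_1\cdots g_n,\ g_i\in w[G]^{\pm1}\}$, where $w[G]^{\pm 1}$ is the set of elements of $w[G]$ and their inverses. The width of $w(G)$ is the supremum of $vl_w(g)$ over all $g\in w(G)$. An isometric action of $G$ on a metric space $X$ is acylindrical if for all $D>0$ there exist $L,N>0$ such that whenever $d(x,y)>L$ the set $\{g\in G \mid d(x,gx)<D \text{ and } d(y,gy)<D\}$ has fewer than $N$ elements. A group $G$ is acylindrically hyperbolic if it has a non-elementary acylindrical isometric action on a $\delta$-hyperbolic (geodesic) space; non-elementary means that the limit set of $G$ in the Gromov boundary has more than two points. *)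

(* Defs.v *)
From HB Require Import structures.
From mathcomp Require Import all_boot all_order all_algebra.
From mathcomp Require Import all_classical all_reals all_analysis.

Set Implicit Arguments.
Unset Strict Implicit.
Unset Printing Implicit Defensive.

Import Order.TTheory GRing.Theory Num.Theory.
Import numFieldNormedType.Exports.

Local Open Scope classical_set_scope.
Local Open Scope ring_scope.

(* A letter [(i, e)] stands for [x_i] if [e = false] and for [x_i^-1] if
   [e = true]; the free group on [k] generators consists of the reduced words,
   multiplied by concatenation followed by free reduction. *)
Definition letter (k : nat) := ('I_k * bool)%type.

Definition letter_inv k (a : letter k) : letter k := (a.1, ~~ a.2).

Definition reduced k (s : seq (letter k)) : bool :=
  sorted (fun a b => b != letter_inv a) s.

Definition red_cons k (a : letter k) (s : seq (letter k)) : seq (letter k) :=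
  if s is b :: s' then if b == letter_inv a then s' else a :: s else [:: a].

Section FreeReduction.
Variable k : nat.
Implicit Types (a : letter k) (s t u : seq (letter k)).

Lemma letter_invK : involutive (@letter_inv k).
Proof. by case=> i e; rewrite /letter_inv /= negbK. Qed.

Lemma reduced_red_cons a s : reduced s -> reduced (red_cons a s).
Proof.
case: s => //= b s; case: ifP => [_ /path_sorted //|ba] bs.
by rewrite /reduced /= ba.
Qed.

Lemma reduced_foldr s t : reduced t -> reduced (foldr (@red_cons k) t s).
Proof. by move=> rt; elim: s => //= a s; apply: reduced_red_cons. Qed.

Lemma red_consK a s : reduced s -> red_cons (letter_inv a) (red_cons a s) = s.
Proof.
case: s => [_|b s] /=; first by rewrite letter_invK eqxx.
case: ifP => [/eqP -> rs|_ _ /=]; last by rewrite letter_invK eqxx.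
case: s rs => [//|c s] /= /andP[cb _].
by rewrite (negPf cb).
Qed.

Lemma red_consVK a s : reduced s -> red_cons a (red_cons (letter_inv a) s) = s.
Proof. by move=> rs; rewrite -{1}(letter_invK a) red_consK. Qed.

Lemma foldr_red_cons a s t : reduced s -> reduced t ->
  foldr (@red_cons k) t (red_cons a s) = red_cons a (foldr (@red_cons k) t s).
Proof.
case: s => //= b s rs rt; case: ifP => // /eqP ->.
by rewrite red_consVK// reduced_foldr.
Qed.

Lemma foldr_red_consA s t u : reduced t -> reduced u ->
  foldr (@red_cons k) u (foldr (@red_cons k) t s) =
  foldr (@red_cons k) (foldr (@red_cons k) u t) s.
Proof.
move=> rt ru; elim: s => //= a s IHs.
by rewrite foldr_red_cons ?IHs// reduced_foldr.
Qed.

Lemma foldr_red_cons_nil s : reduced s -> foldr (@red_cons k) [::] s = s.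
Proof.
elim: s => //= a s IHs ras; rewrite IHs; last exact: path_sorted ras.
by case: s ras {IHs} => //= b s /andP[/negPf ->].
Qed.

Lemma reduced_inv s : reduced s -> reduced (rev (map (@letter_inv k) s)).
Proof.
rewrite /reduced rev_sorted sorted_map; apply: sub_sorted => a b /=.
by apply: contra => /eqP/(can_inj letter_invK) ->; rewrite letter_invK.
Qed.

Lemma foldr_red_cons_inv s t : reduced t ->
  foldr (@red_cons k) (foldr (@red_cons k) t s) (rev (map (@letter_inv k) s)) = t.
Proof.
move=> rt; elim: s => //= a s IHs.
by rewrite rev_cons foldr_rcons red_consK ?IHs// reduced_foldr.
Qed.

End FreeReduction.

Record free_group (k : nat) := FreeGroup {
  fg_word :> seq (letter k);
  fg_reduced : reduced fg_word }.

HB.instance Definition _ k := [isSub for @fg_word k].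
HB.instance Definition _ k := [Choice of free_group k by <:].

Section FreeGroup.
Variable k : nat.
Implicit Types v w : free_group k.

Definition fg_one : free_group k := @FreeGroup k [::] isT.
Definition fg_mul v w := FreeGroup (reduced_foldr v (fg_reduced w)).
Definition fg_inv v := FreeGroup (reduced_inv (fg_reduced v)).

Lemma fg_mulA : associative fg_mul.
Proof.
by move=> u v w; apply/val_inj; rewrite /= foldr_red_consA// fg_reduced.
Qed.

Lemma fg_mul1 : left_id fg_one fg_mul.
Proof. by move=> v; apply/val_inj. Qed.

Lemma fg_mulr1 : right_id fg_one fg_mul.
Proof. by move=> v; apply/val_inj; rewrite /= foldr_red_cons_nil// fg_reduced. Qed.

Lemma fg_mulV : left_inverse fg_one fg_inv fg_mul.
Proof.
move=> v; apply/val_inj => /=.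
by rewrite -[RHS](foldr_red_cons_inv v) // foldr_red_cons_nil// fg_reduced.
Qed.

Lemma fg_mulrV : right_inverse fg_one fg_inv fg_mul.
Proof.
move=> v; have {1}-> : v = fg_inv (fg_inv v).
  apply/val_inj; rewrite /= map_rev revK -map_comp -[LHS]map_id.
  by apply: eq_map => a /=; rewrite letter_invK.
exact: fg_mulV.
Qed.

End FreeGroup.

HB.instance Definition _ k := isGroup.Build (free_group k)
  (@fg_mulA k) (@fg_mul1 k) (@fg_mulr1 k) (@fg_mulV k) (@fg_mulrV k).

Section VerbalWidth.
Variables (k : nat) (G : groupType).
Local Open Scope group_scope.

Definition letter_eval (g : 'I_k -> G) (a : letter k) : G :=
  if a.2 then (g a.1)^-1 else g a.1.

Definition word_map (w : free_group k) (g : 'I_k -> G) : G :=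
  \prod_(a <- fg_word w) letter_eval g a.

Lemma word_mapM (v w : free_group k) (g : 'I_k -> G) :
  word_map (v * w) g = word_map v g * word_map w g.
Proof.
have evalV a : letter_eval g (letter_inv a) = (letter_eval g a)^-1.
  by case: a => i []; rewrite /letter_eval //= invgK.
rewrite /word_map /=; elim: (fg_word v) => [|a s IHs] /=.
  by rewrite big_nil mul1g.
rewrite big_cons -mulgA -{}IHs.
case: (foldr _ _ _) => [|b t] /=; first by rewrite big_seq1 big_nil mulg1.
case: ifP => [/eqP ->|_]; last by rewrite big_cons.
by rewrite big_cons evalV mulVKg.
Qed.

Definition exponent_sum (w : free_group k) (i : 'I_k) : int :=
  (\sum_(a <- fg_word w | a.1 == i) (-1) ^+ a.2)%R.

(* [gcdn 0 0 = 0], so this is [0] when all exponent sums vanish. *)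
Definition exponent_gcd (w : free_group k) : nat :=
  \big[gcdn/0%N]_(i < k) `|exponent_sum w i|%N.

Definition verbal_subset (w : free_group k) : set G := range (word_map w).

Definition is_subgroup (H : set G) : Prop :=
  H 1 /\ forall x y, H x -> H y -> H (x * y^-1).

Definition verbal_subgroup (w : free_group k) : set G :=
  smallest is_subgroup (verbal_subset w).

Definition verbal_product (w : free_group k) (g : G) (n : nat) : Prop :=
  exists s : n.-tuple G,
    (forall x, x \in s -> verbal_subset w x \/ verbal_subset w x^-1) /\
    g = \prod_(x <- s) x.

(* The minimum exists for every [g] in [verbal_subgroup w]; outside of it, the
   value is the irrelevant default [0]. *)
Definition verbal_length (w : free_group k) (g : G) : nat :=
  xget 0%N [set n | verbal_product w g n /\
                    forall m, verbal_product w g m -> (n <= m)%N].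

Definition verbal_width (R : realType) (w : free_group k) : \bar R :=
  ereal_sup [set ((verbal_length w g)%:R%:E : \bar R)
            | g in verbal_subgroup w].

End VerbalWidth.

Arguments verbal_width {k} G R w.

Section HyperbolicSpaces.
Variables (R : realType) (X : metricType R).
Implicit Types (x y z p : X) (u v : nat -> X).

Definition geodesic_path x y (c : R -> X) : Prop :=
  [/\ c 0 = x, c (mdist x y) = y &
    forall s t, s \in `[0, mdist x y] -> t \in `[0, mdist x y] ->
      mdist (c s) (c t) = `|s - t|].

Definition geodesic_space : Prop := forall x y, exists c, geodesic_path x y c.

Definition slim_triangles (delta : R) : Prop :=
  forall x y z (a b c : R -> X),
    geodesic_path x y a -> geodesic_path y z b -> geodesic_path z x c ->
    forall p, (a @` `[0, mdist x y]) p ->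
      exists2 q, (b @` `[0, mdist y z] `|` c @` `[0, mdist z x]) q &
                 mdist p q <= delta.

Definition hyperbolic_space : Prop :=
  geodesic_space /\ exists2 delta, 0 <= delta & slim_triangles delta.

Definition gromov_product p x y : R :=
  (mdist p x + mdist p y - mdist x y) / 2.

(* [u] and [v] converge to a common point at infinity:
   [(u_i | v_j)_p --> +oo] as [i] and [j] tend to infinity independently. *)
Definition gromov_asymptotic p u v : Prop :=
  gromov_product p (u ij.1) (v ij.2)
    @[ij --> filter_prod \oo \oo] --> +oo.

Definition converges_at_infinity p u : Prop := gromov_asymptotic p u u.

(* The Gromov boundary of a hyperbolic space, which need not be proper, is the
   set of asymptoty classes of sequences converging at infinity. The base point
   [p] has no effect on any of these notions. *)
Definition boundary_point p u : set (nat -> X) :=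
  [set v | converges_at_infinity p v /\ gromov_asymptotic p u v].

Definition gromov_boundary p : set (set (nat -> X)) :=
  boundary_point p @` converges_at_infinity p.

End HyperbolicSpaces.

Section Actions.
Variables (R : realType) (G : groupType) (X : metricType R).
Variable act : G -> X -> X.

Definition isometric_action : Prop :=
  [/\ forall x, act 1%g x = x,
      forall g h x, act (g * h)%g x = act g (act h x) &
      forall g x y, mdist (act g x) (act g y) = mdist x y].

Definition acylindrical : Prop :=
  forall D : R, 0 < D ->
  exists (L : R) (N : nat), [/\ 0 < L, (0 < N)%N &
    forall x y, L < mdist x y ->
      exists2 n, (n < N)%N &
        ([set g | mdist x (act g x) < D /\ mdist y (act g y) < D]
           #= `I_n)%card].

(* The points of the boundary that are limits of sequences in the orbit of [p];
   the orbits of all points have the same limits. *)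
Definition limit_set (p : X) : set (set (nat -> X)) :=
  [set xi | gromov_boundary p xi /\
     exists g : nat -> G, xi (fun n => act (g n) p)].

Definition non_elementary : Prop :=
  exists p : X, ~ (limit_set p #<= `I_2)%card.

End Actions.

Definition acylindrically_hyperbolic (R : realType) (G : groupType) : Prop :=
  exists (X : metricType R) (act : G -> X -> X),
    [/\ isometric_action act, hyperbolic_space X,
        acylindrical act & non_elementary act].

(* Main.v *)
Require Import Defs.
From mathcomp Require Import all_boot all_order all_algebra.
From mathcomp Require Import all_classical all_reals all_analysis.
From mathcomp Require Import zify lra.

(** The idea is that signed counts of passages along far away axes form
    integer quasi-homomorphisms [q_i : G -> int] whose total error is bounded
    independently of their number: for all [g], [h], at most [36] indices [i]
    violate [q_i (g h) = q_i g + q_i h].  As the exponent sums of [w] are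
    multiples of [d(w)], every product of [n] values of [w] then has [q_i]
    divisible by [d(w)] for all but O(n) indices, whereas some product of values
    of [w] has [q_i = 1] for all [m] indices, with [m] arbitrary.

    The axes are the cosets of the stabilizer [H] of the axis of a loxodromic
    element [f], with nearest point projections between them; acylindricity gives
    the Behrstock inequality and finiteness.  Exact, as opposed to coarse,
    additivity of the counts requires projections that do not move at all under
    far away changes.  To that end, the projection to [Y] is replaced by the
    classes of the equivalence relation generated by "[Z] separates [X] from [Y]";
    a passage of type [i] is a pair of classes at [Y] in a fixed orbit. *)

Set Implicit Arguments.
Unset Strict Implicit.
Unset Printing Implicit Defensive.

Import Order.TTheory GRing.Theory Num.Theory.

Local Open Scope classical_set_scope.

(** * Projection systems *)

(* [lia] splits on every boolean in the context, so keep the inequalities only. *)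
Ltac nlia := repeat match goal with
  | H : is_true ?b |- _ => lazymatch b with leq _ _ => fail | _ => clear H end
  end; lia.

Ltac neq := solve [done | by rewrite eq_sym].

(** The error is independent of the number of types because the defect of a triple lives on at most
    six axes, its three corners and three branch points, and at a given axis an ordered pair of
    corners is a crossing of at most one type.

    The obstacle on the other side is that the product with all counts 1 has to consist of values of
    [w]. It is built from conjugates [x * beta * v * beta^-1 * x^-1] of one value [v], so every long
    turn [alpha i] is undone later. With the same [b] on both sides of these turns, the passage at
    [(alpha i)^-1] would be a translate of the reverse of the passage at [alpha i], and the two
    would cancel. Hence the second element [b']: the turn [alpha i] leads from a [b']-class to a
    [b]-class, its inverse from a [b]-class to a [b]-class, which counts for nothing. *)

Section ProjectionSystem.
Variables (T : choiceType) (d : T -> T -> T -> nat) (theta : nat).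
Local Open Scope nat_scope.

(* [d Y X Z] is the diameter of the union of the projections of [X] and [Z] to
   [Y], meaningful only when [X] and [Z] differ from [Y]; [prB] is the Behrstock
   inequality. *)
Record projection_system : Prop := ProjectionSystem {
  prC : forall Y X Z, d Y X Z = d Y Z X;
  prD : forall Y X W Z, X != Y -> W != Y -> Z != Y ->
    d Y X Z <= d Y X W + d Y W Z;
  prxx : forall Y X, X != Y -> d Y X X <= theta;
  prB : forall X Y Z, X != Y -> X != Z -> Y != Z ->
    theta < d Y X Z -> d Z X Y <= theta;
  pr_finite : forall X Z,
    finite_set [set Y | [/\ Y != X, Y != Z & theta < d Y X Z]] }.

Hypothesis prT : projection_system.

Lemma pr_bounded X Z : exists S, forall Y, Y != X -> Y != Z -> d Y X Z <= S.
Proof.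
have [s sP] : exists s : seq T, [set Y | [/\ Y != X, Y != Z & theta < d Y X Z]] = [set` s].
  by apply/finite_seqP; exact: (pr_finite prT).
exists (maxn theta (\max_(Y <- s) d Y X Z)) => Y YX YZ; rewrite leq_max.
case: leqP => //= dY; apply: (leq_bigmax_seq (F := fun Y => d Y X Z)) => //.
by have : [set` s] Y by rewrite -sP.
Qed.

(** [Y] is the base and [Z] the separator: [Z] lies between [X] and [Y], its own projections of them
    being far apart. *)
Definition separates K Y X Z := [&& X != Y, Z != Y, Z != X & K < d Z X Y].

Lemma separatesW K K' Y X Z : K' <= K -> separates K Y X Z -> separates K' Y X Z.
Proof. by rewrite /separates => KK /and4P[-> -> ->] /=; nlia. Qed.

Lemma separates_near K Y X Z : theta <= K -> separates K Y X Z ->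
  d Y X Z <= theta /\ d X Z Y <= theta.
Proof.
move=> tK /and4P[XY ZY ZX dZ]; split.
  by apply: (prB prT); try neq; nlia.
rewrite (prC prT); apply: (prB prT); try neq.
by rewrite (prC prT); nlia.
Qed.

(** By the Behrstock inequality [W] and [Y] look alike from [Z], so [X] and [W] are far apart there,
    and [X] and [Z] look alike from [W]. Only the threshold of the separator nearer to [Y] degrades,
    and only by [theta]. *)
Lemma separates_trans K K' Y X Z W : theta.*2 <= K -> theta <= K' ->
    separates K Y X Z -> separates K' Y Z W ->
  d W X Z <= theta /\ separates (K' - theta) Y X W.
Proof.
move=> tK tK' sXZ sZW; have [dYZW dZWY] := separates_near tK' sZW.
move: sXZ sZW => /and4P[XY ZY ZX dZ] /and4P[_ WY WZ dW].
have WX : W != X by apply: contraTneq dZ => <-; rewrite -leqNgt; nlia.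
have dZXW : theta < d Z X W.
  have : d Z X Y <= d Z X W + d Z W Y by apply: (prD prT); neq.
  by nlia.
have dWXZ : d W X Z <= theta by apply: (prB prT); neq.
split=> //; rewrite /separates XY WY WX /=.
have : d W Z Y <= d W Z X + d W X Y by apply: (prD prT); neq.
by rewrite [d W Z X](prC prT); nlia.
Qed.

(** The separators of [X] from [Y] are linearly ordered: either [X] and [Z] look alike from [W],
    which then lies between [Z] and [Y], or [X] and [W] look alike from [Z]. *)
Lemma separates_comparable K K' Y X Z W : theta <= K -> theta <= K' ->
    separates K Y X Z ->
    separates K' Y X W -> Z != W ->
  separates (K' - theta) Y Z W \/ separates (K - theta) Y W Z.
Proof.
move=> tK tK' /and4P[XY ZY ZX dZ] /and4P[_ WY WX dW] ZW.
rewrite /separates ZY WY ZW [W == Z]eq_sym ZW /=.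
have [dWXZ|dWXZ] := leqP (d W X Z) theta.
  have : d W X Y <= d W X Z + d W Z Y by apply: (prD prT); neq.
  left; nlia.
have dZXW : d Z X W <= theta by apply: (prB prT); neq.
have : d Z X Y <= d Z X W + d Z W Y by apply: (prD prT); neq.
by right; nlia.
Qed.

Section ExactProjections.
Variables (Theta : nat) (Y : T).
Hypothesis ThetaP : 4 * theta <= Theta.

(* The class of [X] under [conn] stands for its projection to [Y]: it is within
   [2 * theta] of it, and unchanged by moving [X] beyond a separating [W]. *)
Inductive conn (X : T) : T -> Prop :=
| conn_refl : conn X X
| conn_fwd V W : conn X V -> separates Theta Y V W -> conn X W
| conn_bwd V W : conn X V -> separates Theta Y W V -> conn X W.

Lemma conn_trans X V W : conn X V -> conn V W -> conn X W.
Proof.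
move=> XV; elim=> // W1 W2 _ IH sep; first exact: conn_fwd sep.
exact: conn_bwd sep.
Qed.

Lemma conn_sym X V : conn X V -> conn V X.
Proof.
elim=> [|V1 V2 _ IH sep|V1 V2 _ IH sep]; first exact: conn_refl.
  by apply: conn_trans IH; apply: conn_bwd sep; exact: conn_refl.
by apply: conn_trans IH; apply: conn_fwd sep; exact: conn_refl.
Qed.

Let near_sep V W := V = W \/ separates (Theta - theta.*2) Y V W.

(* The successive blocks, from the closest to [Y] to the current point, that
   the walk has to cross again to leave; each of them keeps its own witness [E]
   at the full threshold [Theta], so that constants do not degrade. *)
Inductive stack (X : T) : T -> Prop :=
| stack_root B : near_sep X B -> stack X B
| stack_push V B E : stack X B -> separates Theta Y E B -> near_sep E V ->
    separates (Theta - theta) Y V B -> stack X V.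

(** No loss accumulates: the new threshold stems from the second separation alone, whatever was lost
    in the first. *)
Lemma near_sep_trans K V W Z : Theta - theta <= K -> near_sep V W ->
  separates K Y W Z -> separates (Theta - theta.*2) Y V Z.
Proof.
move=> KT [->|sVW] sWZ; first by apply: separatesW sWZ; nlia.
have [||_] := separates_trans _ _ sVW sWZ; try nlia.
by apply: separatesW; nlia.
Qed.

(** Both [V'] and the last block [B] separate [E] from [Y], hence are ordered: either [B] still
    blocks the way from [V'], or the walk has passed [B], which is popped. The witness [V0] is kept
    at the full threshold, so repeated pops lose no more than one. *)
Lemma stack_pop X V V0 V' : stack X V -> near_sep V0 V ->
    separates Theta Y V0 V' -> separates (Theta - theta) Y V V' ->
  stack X V'.
Proof.
move=> XV; elim: XV V0 V' => {V} [B XB|V B E XB IH sEB EV sVB] V0 V' V0V sV0 sV.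
  by apply: stack_root; right; apply: near_sep_trans sV.
have sEV' := near_sep_trans (leqnn _) EV sV.
have [->//|BV'] := eqVneq V' B.
have [||sV'B|sBV'] := separates_comparable _ _ sEV' sEB BV'; try nlia.
  by apply: (stack_push XB sEB) => //; right.
have sV0B : separates (Theta - theta.*2) Y V0 B.
  exact: near_sep_trans V0V sVB.
apply: (IH V0) => //; first by right.
have [||dV' _] := separates_trans _ _ sV0B sBV'; try nlia.
move: sBV' sV0 => /and4P[BY V'Y V'B _] /and4P[V0Y _ V'V0 dV0].
rewrite /separates BY V'Y V'B /=.
have : d V' V0 Y <= d V' V0 B + d V' B Y by apply: (prD prT); neq.
by nlia.
Qed.

Lemma conn_stack X V : conn X V -> stack X V.
Proof.
elim=> {V} [|V W _ IH sep|V W _ IH sep].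
- by apply: stack_root; left.
- apply: (stack_pop IH _ sep); first by left.
  by apply: separatesW sep; nlia.
- apply: (stack_push IH sep); first by left.
  by apply: separatesW sep; nlia.
Qed.

(** Crossing the blocks one by one leads to the bottom of the stack, which lies between [Y] and both
    [X] and [V] or equals one of them. A walk of any length is thus replaced by two separations. *)
Lemma conn_root X V : conn X V -> exists B, near_sep X B /\ near_sep V B.
Proof.
have root U : stack X U -> forall W, near_sep W U ->
    exists B, near_sep X B /\ near_sep W B.
  elim=> {U} [B XB|U B E _ IH _ _ sUB] W WU; first by exists B.
  by apply: IH; right; apply: near_sep_trans WU sUB.
by move=> /conn_stack/root; apply; left.
Qed.

Lemma conn_neq X V : conn X V -> X != Y -> V != Y.
Proof. by elim=> // W1 W2 _ IH /and4P[? ? _ _]. Qed.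

Lemma conn_pr X V : X != Y -> conn X V -> d Y X V <= theta.*2.
Proof.
move=> XY XV; have VY := conn_neq XV XY.
have [B [XB VB]] := conn_root XV.
have near W : W != Y -> near_sep W B -> B != Y /\ d Y W B <= theta.
  move=> WY [<-|sWB]; first by split=> //; exact: (prxx prT).
  have [|? _] := separates_near _ sWB; first by nlia.
  by case/and4P: sWB.
have [BY dXB] := near X XY XB; have [_ dVB] := near V VY VB.
have : d Y X V <= d Y X B + d Y B V by apply: (prD prT).
by rewrite [d Y B V](prC prT); nlia.
Qed.

(** A point that nothing separates from [Y] is its own root. This is the means of showing that two
    classes differ. *)
Lemma conn_unseparated X V : conn X V ->
    (forall W, W != X -> W != Y -> d W X Y <= Theta - theta.*2) ->
    (forall W, W != V -> W != Y -> d W V Y <= Theta - theta.*2) ->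
  X = V.
Proof.
have root W B : near_sep W B ->
    (forall U, U != W -> U != Y -> d U W Y <= Theta - theta.*2) -> W = B.
  by case=> // /and4P[_ BY BW dB] /(_ B BW BY); nlia.
by move=> /conn_root[B [XB VB]] /(root _ _ XB) -> /(root _ _ VB) ->.
Qed.

End ExactProjections.
End ProjectionSystem.

(** * Counting crossings *)

Section Counting.
Variables (G : groupType) (T : choiceType) (act : G -> T -> T).
Variables (d : T -> T -> T -> nat) (theta : nat).
Local Open Scope nat_scope.

Record equivariant_system : Prop := EquivariantSystem {
  es_pr :> projection_system d theta;
  es_act1 : forall X, act 1%g X = X;
  es_actM : forall g h X, act (g * h)%g X = act g (act h X);
  es_equiv : forall g Y X Z, d (act g Y) (act g X) (act g Z) = d Y X Z }.

Hypothesis esT : equivariant_system.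

Lemma actK g : cancel (act g) (act g^-1%g).
Proof. by move=> X; rewrite -(es_actM esT) mulVg (es_act1 esT). Qed.

Lemma actVK g : cancel (act g^-1%g) (act g).
Proof. by move=> X; rewrite -(es_actM esT) mulgV (es_act1 esT). Qed.

Lemma act_eq g X Z : (act g X == act g Z) = (X == Z).
Proof. exact: (can_eq (actK g)). Qed.

Definition fixes g Y := act g Y = Y.

Lemma fixesM g h Y : fixes g Y -> fixes h Y -> fixes (g * h)%g Y.
Proof. rewrite /fixes (es_actM esT) => gY ->. by []. Qed.

Lemma fixesV g Y : fixes g Y -> fixes g^-1%g Y.
Proof. by move=> gY; rewrite /fixes -{1}gY actK. Qed.

Lemma fixesX g n Y : fixes g Y -> fixes (g ^+ n)%g Y.
Proof.
move=> gY; elim: n => [|n IH]; first by rewrite /fixes expg0 (es_act1 esT).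
by rewrite expgS; apply: fixesM.
Qed.

Lemma fixesVE g Y : fixes g^-1%g Y -> fixes g Y.
Proof. by move=> /fixesV; rewrite invgK. Qed.

Lemma act_neq g X : (act g X != X) = (act g^-1%g X != X).
Proof.
by apply/idP/idP; apply: contra => /eqP; rewrite -/(fixes _ _);
  [move/fixesVE/eqP|move/fixesV/eqP].
Qed.

Lemma d_act g Y X Z : d Y (act g X) Z = d (act g^-1%g Y) X (act g^-1%g Z).
Proof. by rewrite -[RHS](es_equiv esT g) !actVK. Qed.

Lemma conn_act Theta g Y X Z : conn d Theta Y X Z ->
  conn d Theta (act g Y) (act g X) (act g Z).
Proof.
have sepE K U V W : separates d K (act g U) (act g V) (act g W) =
    separates d K U V W by rewrite /separates !act_eq (es_equiv esT).
elim=> [|V W _ IH|V W _ IH]; first exact: conn_refl.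
  by rewrite -sepE; exact: conn_fwd.
by rewrite -sepE; exact: conn_bwd.
Qed.

Variables (Theta : nat) (Y0 P : T) (m : nat) (Q : 'I_m -> T).
Hypothesis ThetaP : 4 * theta <= Theta.
Hypothesis PY0 : P != Y0.
Hypothesis QY0 : forall i, Q i != Y0.
(** Changing the ends within their classes costs [4 * theta], and the rest exceeds
    [2 * (Theta + theta)]; so every third point is farther than [Theta + theta] from one of the
    ends, as [apex] requires. *)
Hypothesis dPQ : forall i, 2 * Theta + 8 * theta < d Y0 P (Q i).
Hypothesis dPQ_sparse : forall i j : 'I_m,
  i < j -> d Y0 P (Q i) + 8 * theta < d Y0 P (Q j).

(* A crossing of type [i] is a translate of the pair of classes of [P] and [Q i]
   at [Y0]; the type is determined by the distance between [P] and [Q i], which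
   [dPQ_sparse] spreads out. *)
Definition crossing i Y X Z := [/\ X != Y, Z != Y & exists g,
  [/\ act g Y0 = Y, conn d Theta Y X (act g P) & conn d Theta Y Z (act g (Q i))]].

Lemma crossing_pr i Y X Z : crossing i Y X Z ->
  d Y X Z <= d Y0 P (Q i) + 4 * theta /\ d Y0 P (Q i) <= d Y X Z + 4 * theta.
Proof.
case=> XY ZY [g [gY XP ZQ]].
have gPY : act g P != Y by rewrite -gY act_eq.
have gQY : act g (Q i) != Y by rewrite -gY act_eq.
have dXP := conn_pr esT ThetaP XY XP; have dZQ := conn_pr esT ThetaP ZY ZQ.
have dE : d Y0 P (Q i) = d Y (act g P) (act g (Q i)).
  by rewrite -gY (es_equiv esT).
have := prD esT XY gPY ZY; have := prD esT gPY gQY ZY.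
have := prD esT gPY XY gQY; have := prD esT XY ZY gQY.
have := prC esT; move=> C.
by rewrite dE ?(C Y (act g P) X) ?(C Y (act g (Q i)) Z); nlia.
Qed.

Lemma crossing_inj i j Y X Z : crossing i Y X Z -> crossing j Y X Z -> i = j.
Proof.
move=> /crossing_pr[di1 di2] /crossing_pr[dj1 dj2]; apply/val_inj.
by case: (ltngtP i j) => // /dPQ_sparse /=; nlia.
Qed.

Lemma crossing_conn i Y X Z X' Z' : conn d Theta Y X X' -> conn d Theta Y Z Z' ->
  crossing i Y X Z -> crossing i Y X' Z'.
Proof.
move=> XX' ZZ' [XY ZY [g [gY XP ZQ]]]; split.
- exact: conn_neq XX' XY.
- exact: conn_neq ZZ' ZY.
- exists g; split=> //.
    by apply: conn_trans XP; exact: conn_sym.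
  by apply: conn_trans ZQ; exact: conn_sym.
Qed.

Lemma crossing_act i g Y X Z : crossing i Y X Z ->
  crossing i (act g Y) (act g X) (act g Z).
Proof.
move=> [XY ZY [h [hY XP ZQ]]]; split; rewrite ?act_eq//.
exists (g * h)%g; rewrite !(es_actM esT) hY.
by split=> //; exact: conn_act.
Qed.

Lemma crossing_actE i g Y X Z :
  crossing i (act g Y) (act g X) (act g Z) <-> crossing i Y X Z.
Proof.
split=> [/(crossing_act g^-1%g)|]; last exact: crossing_act.
by rewrite !actK.
Qed.

Definition ncross i Y X Z : int := (`[<crossing i Y X Z>] : nat)%:Z.

Definition signed_cross i Y X Z : int := (ncross i Y X Z - ncross i Y Z X)%R.

(** The sum over all axes is meaningful because its support is finite, by [signed_cross_finite]. *)
Definition cross_count i X Z : int := (\sum_(Y \in [set: T]) signed_cross i Y X Z)%R.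

Lemma signed_crossC i Y X Z : signed_cross i Y X Z = (- signed_cross i Y Z X)%R.
Proof. by rewrite /signed_cross GRing.opprB. Qed.

Lemma signed_cross_neq0 i Y X Z : signed_cross i Y X Z != 0%R ->
  crossing i Y X Z \/ crossing i Y Z X.
Proof.
rewrite /signed_cross /ncross.
by case: asboolP; [left|case: asboolP; [right|rewrite GRing.subrr eqxx]].
Qed.

Lemma crossing_far i Y X Z : crossing i Y X Z -> 2 * Theta + 4 * theta < d Y X Z.
Proof. by move=> /crossing_pr[_]; have := dPQ i; nlia. Qed.

Lemma signed_cross_finite i X Z :
  finite_set [set Y | signed_cross i Y X Z != 0%R].
Proof.
apply: sub_finite_set (pr_finite esT X Z) => Y /= /signed_cross_neq0.
case=> [/[dup]/crossing_far + [XY ZY _]|/[dup]/crossing_far + [XY ZY _]].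
  by move=> ?; split; [neq|neq|nlia].
by rewrite (prC esT) => ?; split; [neq|neq|nlia].
Qed.

Lemma countC i X Z : cross_count i X Z = (- cross_count i Z X)%R.
Proof.
rewrite /cross_count -[RHS]mulN1r mulr_fsumr.
by apply: eq_fsbigr => Y _; rewrite mulN1r signed_crossC.
Qed.

Lemma count_act i g X Z : cross_count i (act g X) (act g Z) = cross_count i X Z.
Proof.
rewrite /cross_count (reindex_fsbigT (act g)); last first.
  by exists (act g^-1%g) => ?; rewrite (actK, actVK).
apply: eq_fsbigr => Y _; rewrite /signed_cross /ncross.
by congr (Posz _ - Posz _)%R; congr nat_of_bool;
  apply/asbool_equiv_eq; exact: crossing_actE.
Qed.

Lemma signed_cross_eq0 i Y X Z : ~ crossing i Y X Z -> ~ crossing i Y Z X ->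
  signed_cross i Y X Z = 0%R.
Proof. by move=> ? ?; rewrite /signed_cross /ncross !asboolF. Qed.

Definition defect i X Z W Y :=
  (signed_cross i Y X Z + (signed_cross i Y Z W + signed_cross i Y W X))%R.

Lemma count_defect i X Z W :
  cross_count i X W != (cross_count i X Z + cross_count i Z W)%R ->
  exists Y, defect i X Z W Y != 0%R.
Proof.
apply: contra_neqP => /forallNP def0.
pose A := [set Y | signed_cross i Y X Z != 0%R] `|`
  ([set Y | signed_cross i Y Z W != 0%R] `|` [set Y | signed_cross i Y W X != 0%R]).
have finA : finite_set A by rewrite !finite_setU; split; [|split]; exact: signed_cross_finite.
have countA U V : [set Y | signed_cross i Y U V != 0%R] `<=` A ->
    cross_count i U V = (\sum_(Y \in A) signed_cross i Y U V)%R.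
  move=> UV; apply/esym/fsbig_widen => // Y [_ AY] /=.
  by apply: contra_notP AY => /eqP/UV.
suff : (cross_count i X Z + (cross_count i Z W + cross_count i W X) = 0)%R.
  by rewrite [cross_count i W X]countC => /eqP; rewrite GRing.addrA GRing.subr_eq0 => /eqP.
rewrite !countA; try by move=> Y; rewrite /A /=; tauto.
rewrite -!fsbig_split//; apply: fsbig1 => Y _.
by apply/eqP/negPn/negP; exact: def0.
Qed.

(** Crossings only see classes, and the cyclic sum of an antisymmetric function vanishes when two
    corners agree. *)
Lemma defect_conn i X Z W Y : conn d Theta Y X Z -> defect i X Z W Y = 0%R.
Proof.
have cr U V U' V' : conn d Theta Y U U' -> conn d Theta Y V V' ->
    ncross i Y U V = ncross i Y U' V'.
  move=> UU' VV'; rewrite /ncross; congr Posz; congr nat_of_bool.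
  apply/asbool_equiv_eq; split; apply: crossing_conn => //; exact: conn_sym.
move=> XZ; have ZX := conn_sym XZ.
have rfl U : conn d Theta Y U U by exact: conn_refl.
rewrite /defect /signed_cross (cr _ _ _ _ XZ (rfl Z)) (cr _ _ _ _ (rfl Z) XZ).
by rewrite (cr _ _ _ _ (rfl W) XZ) (cr _ _ _ _ XZ (rfl W)); nlia.
Qed.

Lemma defect_rot i X Z W Y : defect i X Z W Y = defect i Z W X Y.
Proof. by rewrite /defect; nlia. Qed.

(* The branch points of the tripod [X], [Z], [W]: the classes of [Z] and [W] at
   [Y] already differ although [Y] is far from [X]. *)
Definition apex X Z W Y := [/\ [&& X != Y, Z != Y & W != Y],
  Theta + theta < d Y X Z, Theta + theta < d Y X W & ~ conn d Theta Y Z W].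

(** Two apexes both separate [Z] from [X], hence are ordered. The one farther from [X] separates
    both [Z] and [W] from the other, at which the classes of [Z] and [W] then agree. *)
Lemma apex_inj X Z W Y Y' : apex X Z W Y -> apex X Z W Y' -> Y = Y'.
Proof.
wlog: Y Y' / separates d Theta X Y Y' => [wl|].
  move=> aY aY'; have [//|YY'] := eqVneq Y Y'.
  case: (aY) => /and3P[XY ZY WY] dXZ dXW _.
  case: (aY') => /and3P[XY' ZY' WY'] dXZ' dXW' _.
  have [XZ|XZ] := eqVneq Z X.
    by have := prxx esT XY; rewrite -{2}XZ; nlia.
  have sY : separates d (Theta + theta) X Z Y.
    by rewrite /separates XZ (prC esT) /=; apply/and3P; split; [neq|neq|].
  have sY' : separates d (Theta + theta) X Z Y'.
    by rewrite /separates XZ (prC esT) /=; apply/and3P; split; [neq|neq|].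
  have [||s|s] := separates_comparable esT _ _ sY sY' YY'; try nlia.
    by apply: wl => //; apply: separatesW s; nlia.
  by apply/esym/wl => //; apply: separatesW s; nlia.
move=> sY [/and3P[XY ZY WY] dXZ dXW nZW] [/and3P[XY' ZY' WY'] _ _ nZW'].
case: nZW'; have [|_ dYY'] := separates_near esT _ sY; first by nlia.
have Y'Y : Y' != Y by case/and4P: sY.
have sep U : U != Y -> U != Y' -> Theta + theta < d Y X U -> separates d Theta Y' U Y.
  move=> UY UY' dXU; rewrite /separates UY' /=; apply/and3P; split; try neq.
  have : d Y X U <= d Y X Y' + d Y Y' U by apply: (prD esT); neq.
  by have := prC esT Y; move=> C; rewrite (C U Y') (C X Y'); nlia.
apply: (conn_bwd (V := Y)); last exact: sep.
by apply: (conn_fwd (conn_refl _ _ _ _)); exact: sep.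
Qed.

Lemma apex_far X Z W Y : [&& X != Y, Z != Y & W != Y] ->
    2 * Theta + 4 * theta < d Y X Z ->
    ~ conn d Theta Y Z W -> ~ conn d Theta Y W X ->
  apex X Z W Y \/ apex Z W X Y.
Proof.
move=> /and3P[XY ZY WY] dXZ nZW nWX.
have : d Y X Z <= d Y X W + d Y W Z by exact: (prD esT).
rewrite (prC esT Y W Z) => tri.
have [dXW|dXW] := ltnP (Theta + theta) (d Y X W); [left|right]; split => //.
- by apply/and3P.
- by nlia.
- by apply/and3P.
- by nlia.
- by rewrite (prC esT); nlia.
Qed.

(** The axes that may carry a defect: the three corners and the three branch points. With the six
    ordered pairs of corners in [side], they give the constant 36. *)
Definition special X Z W (k : 'I_6) Y : Prop :=
  match val k with
  | 0 => Y = X | 1 => Y = Z | 2 => Y = W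
  | 3 => apex X Z W Y | 4 => apex Z W X Y | _ => apex W X Z Y
  end.

Definition side X Z W (k : 'I_6) i Y : Prop :=
  match val k with
  | 0 => crossing i Y X Z | 1 => crossing i Y Z X | 2 => crossing i Y Z W
  | 3 => crossing i Y W Z | 4 => crossing i Y W X | _ => crossing i Y X W
  end.

Lemma special_inj X Z W k Y Y' : special X Z W k Y -> special X Z W k Y' -> Y = Y'.
Proof.
case: k => -[|[|[|[|[|k]]]]] lt_k6 /=; rewrite /special /=; try by move=> -> ->.
all: exact: apex_inj.
Qed.

Lemma side_inj X Z W k i j Y : side X Z W k i Y -> side X Z W k j Y -> i = j.
Proof.
case: k => -[|[|[|[|[|k]]]]] lt_k6 /=; rewrite /side /=; exact: crossing_inj.
Qed.

(** Away from the corners, a defect makes the three classes pairwise distinct and one of the sides a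
    crossing. That side is long, so the third corner is far from one of its ends, which makes [Y] an
    apex. *)
Lemma defect_special i X Z W Y : defect i X Z W Y != 0%R ->
  (exists k, side X Z W k i Y) /\ (exists k, special X Z W k Y).
Proof.
move=> nz; split.
  apply: contra_neqP nz => /forallNP nk.
  have n0 := nk (@Ordinal 6 0 isT); have n1 := nk (@Ordinal 6 1 isT).
  have n2 := nk (@Ordinal 6 2 isT); have n3 := nk (@Ordinal 6 3 isT).
  have n4 := nk (@Ordinal 6 4 isT); have n5 := nk (@Ordinal 6 5 isT).
  by rewrite /defect !signed_cross_eq0.
have [->|XY] := eqVneq X Y; first by exists (@Ordinal 6 0 isT).
have [->|ZY] := eqVneq Z Y; first by exists (@Ordinal 6 1 isT).
have [->|WY] := eqVneq W Y; first by exists (@Ordinal 6 2 isT).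
have nXZ : ~ conn d Theta Y X Z.
  by move=> XZ; rewrite (defect_conn i W XZ) eqxx in nz.
have nZW : ~ conn d Theta Y Z W.
  by move=> ZW; rewrite defect_rot (defect_conn i X ZW) eqxx in nz.
have nWX : ~ conn d Theta Y W X.
  by move=> WX; rewrite -defect_rot (defect_conn i Z WX) eqxx in nz.
have far U V : signed_cross i Y U V != 0%R -> 2 * Theta + 4 * theta < d Y U V.
  by move=> /signed_cross_neq0[]/crossing_far; rewrite // (prC esT).
have [eXZ|/far dXZ] := eqVneq (signed_cross i Y X Z) 0%R; last first.
  have [] := apex_far (W := W) _ dXZ nZW nWX; first by apply/and3P.
    by exists (@Ordinal 6 3 isT).
  by exists (@Ordinal 6 4 isT).
have [eZW|/far dZW] := eqVneq (signed_cross i Y Z W) 0%R; last first.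
  have [] := apex_far (W := X) _ dZW nWX nXZ; first by apply/and3P.
    by exists (@Ordinal 6 4 isT).
  by exists (@Ordinal 6 5 isT).
have [eWX|/far dWX] := eqVneq (signed_cross i Y W X) 0%R; last first.
  have [] := apex_far (W := Z) _ dWX nXZ nZW; first by apply/and3P.
    by exists (@Ordinal 6 5 isT).
  by exists (@Ordinal 6 3 isT).
by move: nz; rewrite /defect eXZ eZW eWX.
Qed.

Lemma card_le_rel (A : {set 'I_m}) (K : finType) (r : K -> 'I_m -> Prop) :
    (forall i, i \in A -> exists k, r k i) ->
    (forall k i j, r k i -> r k j -> i = j) ->
  #|A| <= #|K|.
Proof.
move=> rA rinj.
have [f fP] : {f : 'I_m -> option K & forall i, i \in A ->
    exists2 k, f i = Some k & r k i}.
  apply: (@boolp.choice _ _ (fun i o => i \in A -> exists2 k, o = Some k & r k i)) => i.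
  have [/rA[k rk]|_] := boolP (i \in A); first by exists (Some k) => _; exists k.
  by exists None.
have finj : {in A &, injective f}.
  by move=> i j /fP[k -> rki] /fP[l -> rlj] [kl]; apply: rinj rki _; rewrite kl.
rewrite -(card_in_imset finj).
have /subset_leq_card/leq_trans : (f @: A)%SET \subset (Some @: [set: K])%SET.
  apply/fintype.subsetP => _ /imsetP[i /fP[k -> _] ->].
  by apply: imset_f; rewrite finset.inE.
by apply; apply: leq_trans (leq_imset_card _ _) _; rewrite cardsT.
Qed.

(** A failing index is recovered from the special axis that carries its defect and the ordered pair
    of corners that is a crossing there. *)
Lemma count_cocycle X Z W :
  #|[set i | cross_count i X W != (cross_count i X Z + cross_count i Z W)%R]%SET| <= 36.
Proof.
have -> : 36 = #|{: 'I_6 * 'I_6}| by rewrite card_prod card_ord.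
apply: (@card_le_rel _ _ (fun kl i => exists Y,
  special X Z W kl.1 Y /\ side X Z W kl.2 i Y)).
  move=> i; rewrite finset.inE => /count_defect[Y /defect_special[[l sl] [k sk]]].
  by exists (k, l), Y.
move=> [k l] i j [Y /= [sY ciY]] [Y' [sY' cjY']].
by move: cjY'; rewrite -(special_inj sY sY') => cjY; exact: side_inj ciY cjY.
Qed.

End Counting.

(** * Quasi-homomorphisms on products of values of a word *)

Section QuasiHomomorphism.
Variables (G : groupType) (m C : nat) (q : G -> 'I_m -> int).
Local Open Scope nat_scope.

Hypothesis qV : forall g i, q g^-1%g i = (- q g i)%R.
Hypothesis qM : forall g h, #|[set i | q (g * h)%g i != (q g i + q h i)%R]%SET| <= C.

Lemma card_set_le2 (I : finType) (P Q1 Q2 : pred I) :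
    (forall i, P i -> Q1 i || Q2 i) ->
  #|[set i | P i]%SET| <= #|[set i | Q1 i]%SET| + #|[set i | Q2 i]%SET|.
Proof.
move=> PQ; apply: leq_trans (leq_card_setU _ _); apply/subset_leq_card/fintype.subsetP.
by move=> i; rewrite !finset.inE; exact: PQ.
Qed.

Lemma quasi1 i : q 1%g i = 0%R.
Proof.
by have /eqP := qV 1%g i; rewrite monoid.invg1 -GRing.addr_eq0 -mulr2n mulrn_eq0 => /eqP.
Qed.

Variables (k : nat) (w : free_group k).

Lemma quasi_word (g : 'I_k -> G) (s : seq (letter k)) :
  #|[set i | q (\prod_(a <- s) letter_eval g a)%g i !=
             (\sum_(a <- s) (-1) ^+ a.2 * q (g a.1) i)%R]%SET| <= C * size s.
Proof.
elim: s => [|a s IH] /=.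
  rewrite muln0 leqn0 cards_eq0; apply/eqP/setP => i.
  by rewrite !finset.inE !big_nil quasi1 eqxx.
rewrite mulnS.
apply: leq_trans (leq_add (qM (letter_eval g a) (\prod_(b <- s) letter_eval g b)%g) IH).
apply: card_set_le2 => i; rewrite !big_cons -negb_and; apply: contra => /andP[/eqP -> /eqP ->].
by rewrite /letter_eval; case: a => j [] /=; rewrite ?qV ?expr1 ?expr0 ?mulN1r ?mul1r.
Qed.

(** Collecting the letters by generator turns the coefficients into exponent sums. *)
Lemma dvdz_exponent_sum (g : 'I_k -> G) i :
  ((exponent_gcd w)%:Z %| (\sum_(a <- fg_word w) (-1) ^+ a.2 * q (g a.1) i)%R)%Z.
Proof.
rewrite (eq_bigr (fun a : letter k =>
    \sum_(j < k | a.1 == j) (-1) ^+ a.2 * q (g j) i)%R); last first.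
  by move=> a _; rewrite (big_pred1 a.1).
rewrite (exchange_big_dep predT)//=; apply: rpred_sum => j _.
rewrite -mulr_suml; apply: dvdz_mulr; rewrite dvdzE /=.
exact: biggcdn_inf (dvdnn _).
Qed.

(** Divisibility by 0 means vanishing, so the cases d(w) = 0 and d(w) > 1 need no distinction. *)
Definition nondiv (v : 'I_m -> int) := #|[set i | ~~ ((exponent_gcd w)%:Z %| v i)%Z]%SET|.

Lemma nondiv_verbal x : verbal_subset w x -> nondiv (q x) <= C * size w.
Proof.
move=> [g _ <-]; apply: leq_trans (quasi_word g w).
apply/subset_leq_card/fintype.subsetP => i; rewrite !finset.inE; apply: contra.
by move=> /eqP ->; exact: dvdz_exponent_sum.
Qed.

Lemma nondiv_product g n : verbal_product w g n -> nondiv (q g) <= n * (C * size w + C).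
Proof.
move=> [s [sw ->]]; rewrite -{2}(size_tuple s).
have {}sw : forall x, x \in tval s -> verbal_subset w x \/ verbal_subset w x^-1%g.
  exact: sw.
elim: (tval s) sw => [|x t IH] xtw.
  rewrite leqn0 cards_eq0; apply/eqP/setP => i.
  by rewrite !finset.inE big_nil quasi1 dvdz0.
rewrite big_cons mulSn; set y := (\prod_(z <- t) z)%g.
have nx : nondiv (q x) <= C * size w.
  have [|/nondiv_verbal] := xtw x (mem_head _ _); first exact: nondiv_verbal.
  by congr (_ <= _); apply: eq_card => i; rewrite !finset.inE qV rpredN.
have {}IH : nondiv (q y) <= size t * (C * size w + C).
  by apply: IH => z zt; apply: xtw; rewrite inE zt orbT.
apply: leq_trans (leq_add (leq_add nx (qM x y)) IH).
apply: leq_trans (card_set_le2 (Q1 := fun i => ~~ ((exponent_gcd w)%:Z %| q x i)%Z ||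
    (q (x * y)%g i != (q x i + q y i)%R))
  (Q2 := fun i => ~~ ((exponent_gcd w)%:Z %| q y i)%Z) _) _.
  move=> i; rewrite orbAC -negb_and orbC; case: eqVneq => //= ->.
  by apply: contra => /andP[? ?]; exact: rpredD.
by rewrite leq_add2r; apply: card_set_le2.
Qed.

End QuasiHomomorphism.

(** * Ping-pong *)

Section Pingpong.
Variables (G : groupType) (T : choiceType) (act : G -> T -> T).
Variables (d : T -> T -> T -> nat) (theta : nat) (Y0 : T) (f b : G).
Local Open Scope nat_scope.

Record loxodromic_system : Prop := LoxodromicSystem {
  ls_es :> equivariant_system act d theta;
  ls_fix : act f Y0 = Y0;
  ls_translate : forall X Z K, X != Y0 -> Z != Y0 ->
    exists N, forall n, N <= n -> K <= d Y0 X (act (f ^+ n)%g Z);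
  ls_move : act b Y0 != Y0 }.

Hypothesis lsT : loxodromic_system.

Lemma ls_translate_seq (s : seq (T * T)) K :
    (forall p, p \in s -> (p.1 != Y0) && (p.2 != Y0)) ->
  exists N, forall n p, N <= n -> p \in s -> K <= d Y0 p.1 (act (f ^+ n)%g p.2).
Proof.
elim: s => [|p s IH] sY0; first by exists 0.
have [|N1 N1P] := IH; first by move=> q qs; apply: sY0; rewrite inE qs orbT.
have /andP[p1 p2] := sY0 _ (mem_head _ _).
have [N2 N2P] := ls_translate lsT K p1 p2; exists (maxn N1 N2) => n q.
rewrite geq_max inE => /andP[n1 n2] /orP[/eqP->|qs]; first exact: N2P.
exact: N1P.
Qed.

Lemma expg_conjV (x y : G) n : ((x * y * x^-1) ^+ n = x * y ^+ n * x^-1)%g.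
Proof.
elim: n => [|n IH]; first by rewrite !expg0 mulg1 mulgV.
by rewrite !expgS IH !mulgA mulgVK.
Qed.

Section FreeSubgroup.
Variables (k : nat) (w : free_group k).

Let V := act b Y0.
Let U := act b^-1%g Y0.

(** The elements [h j] are conjugates of a large power of [f] that fix the axes [Z j]. These axes
    are spread out along [Y0], so from each of them [Y0] and all the others look alike, while the
    powers of [h j] move this common projection far away. *)
Lemma pingpong : w <> 1%g -> exists g : 'I_k -> G, act (word_map w g) Y0 != Y0.
Proof.
have VY0 : V != Y0 := ls_move lsT.
have UY0 : U != Y0 by rewrite /U -(act_neq lsT).
have fY0 n : act (f ^+ n)%g Y0 = Y0 := fixesX lsT n (ls_fix lsT).
have fVY0 n : act (f ^+ n)^-1%g Y0 = Y0 := fixesV lsT (fY0 n).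
have [M MP] := ls_translate lsT theta.+1 VY0 VY0.
(* The bound [5 * theta] leaves [3 * theta] when [Y0] is replaced by a point whose projection is
   within [2 * theta]; this margin restores the [2 * theta] at the next axis. *)
have [N NP] := ls_translate lsT (5 * theta).+1 UY0 UY0.
have [a aE] : exists a : 'I_k -> G, forall j, a j = (f ^+ (j * M) * b)%g by eexists.
pose h j := (a j * f ^+ N.+1 * (a j)^-1)%g.
pose Z j := act (a j) Y0.
have aVY0 j : act (a j)^-1%g Y0 = U.
  by rewrite aE invgM (es_actM lsT) fVY0.
have ZY0 j : Z j != Y0 by rewrite /Z (act_neq lsT) aVY0.
have far (i j : 'I_k) : i < j -> theta < d Y0 (Z i) (Z j).
  move=> ij; have -> : d Y0 (Z i) (Z j) = d Y0 V (act (f ^+ ((j - i) * M))%g V).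
    rewrite /Z !aE !(es_actM lsT) (d_act lsT) fVY0 -(es_actM lsT); congr (d _ _ (act _ _)).
    by rewrite -{1}(subnK (ltnW ij)) addnC mulnDl expgnDr mulKg.
  apply: MP; rewrite leq_pmull// subn_gt0//.
have ZZ (i j : 'I_k) : i != j -> Z i != Z j.
  wlog: i j / i < j => [wl ij|ij _].
    case: (ltngtP i j) => [lt_ij|lt_ji|/val_inj eq_ij]; first exact: wl.
      by rewrite eq_sym; apply: wl; rewrite // eq_sym.
    by rewrite eq_ij eqxx in ij.
  by apply: contraTneq (far _ _ ij) => ->; rewrite -leqNgt (prxx lsT).
have dZZ (i j : 'I_k) : i != j -> d (Z i) (Z j) Y0 <= theta.
  move=> ij; apply: (prB lsT) => //; rewrite 1?eq_sym//; first exact: ZZ.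
  case: (ltngtP i j) ij => [/far|/far //|/val_inj->]; rewrite ?eqxx//.
  by rewrite (prC lsT).
have hZ l : fixes act (letter_eval h l) (Z l.1).
  have hj j : fixes act (h j) (Z j).
    rewrite /fixes /h /Z -!(es_actM lsT) mulgVK (es_actM lsT) fY0.  by [].
  by case: l => j [] /=; rewrite /letter_eval /=; [apply: (fixesV lsT)|].
have big l n : 5 * theta < d (Z l.1) Y0 (act (letter_eval h l ^+ n.+1)%g Y0).
  have hX j p : (h j ^+ p = a j * f ^+ (N.+1 * p) * (a j)^-1)%g.
    by rewrite /h expg_conjV expgnA.
  have hj j : 5 * theta < d (Z j) Y0 (act (h j ^+ n.+1)%g Y0).
    rewrite hX -(es_equiv lsT (a j)^-1%g) (actK lsT) -!(es_actM lsT) !mulgA mulVg mul1g.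
    by rewrite (es_actM lsT) aVY0; apply: NP; lia.
  case: l => j [] /=; rewrite /letter_eval /= ?hj//.
  rewrite expVgn (prC lsT) (d_act lsT).
  have /(fixesV lsT)/(fixesV lsT) : fixes act (h j ^+ n.+1)%g (Z j).
    by apply: (fixesX lsT); exact: (hZ (j, false)).
  by rewrite invgK => ->; rewrite (prC lsT) (prC lsT) hj.
pose x s := (\prod_(l <- s) letter_eval h l)%g.
have dV l n W : W != Z l.1 -> d (Z l.1) W Y0 <= 2 * theta ->
    let X := act (letter_eval h l ^+ n.+1)%g W in
    X != Z l.1 /\ 3 * theta < d (Z l.1) X Y0.
  move=> WZ dW X.
  have lZ : act (letter_eval h l ^+ n.+1)%g (Z l.1) = Z l.1 := fixesX lsT n.+1 (hZ l).
  have XZ : X != Z l.1 by rewrite -lZ (act_eq lsT).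
  have lY0 : act (letter_eval h l ^+ n.+1)%g Y0 != Z l.1.
    by rewrite -lZ (act_eq lsT) eq_sym.
  split=> //; have := big l n; set lY := act _ Y0.
  have : d (Z l.1) Y0 lY <= d (Z l.1) Y0 X + d (Z l.1) X lY by apply: (prD lsT); neq.
  have -> : d (Z l.1) X lY = d (Z l.1) W Y0 by rewrite -{1}lZ (es_equiv lsT).
  by rewrite [d _ Y0 X](prC lsT); nlia.
(* The leading run of equal letters is read as one power: in a reduced word neighbouring letters
   with the same generator are equal, and only a change of axis re-establishes the bound on [W]. *)
have main l s : reduced (l :: s) -> exists n W, [/\ W != Z l.1,
    d (Z l.1) W Y0 <= 2 * theta & act (x (l :: s)) Y0 = act (letter_eval h l ^+ n.+1)%g W].
  elim: s l => [|c s IH] l.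
    exists 0, Y0; rewrite /x big_seq1 eq_sym; split=> //.
    by apply: leq_trans (prxx lsT _) _; rewrite 1?eq_sym//; lia.
  move=> /andP[cl cs]; have [n [W [WZ dW xW]]] := IH c cs.
  have [lc|lc] := eqVneq l.1 c.1.
    have {}lc : l = c.
      move: cl; rewrite /letter_inv lc; case: (l) (c) lc => i e [j e'] /= ->.
      by rewrite xpair_eqE eqxx /=; case: e e' => [] [].
    exists n.+1, W; rewrite lc; split=> //.
    by rewrite /x big_cons (es_actM lsT) -/(x _) xW -(es_actM lsT) -expgS.
  have [XZ dX] := dV c n W WZ dW; move: XZ dX; set X := act _ W => XZ dX.
  exists 0, X; rewrite expg1; split.
  - apply: contraTneq dX => ->; rewrite -leqNgt.
    by apply: leq_trans (dZZ _ _ _) _; rewrite // 1?eq_sym//; nlia.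
  - have ZlZc := ZZ _ _ lc; have cl1 : c.1 != l.1 by rewrite eq_sym.
    have dZ1 := dZZ _ _ cl1; have dZ2 := dZZ _ _ lc.
    have XZl : X != Z l.1 by apply: contraTneq dX => ->; rewrite -leqNgt; nlia.
    have tri : d (Z c.1) X Y0 <= d (Z c.1) X (Z l.1) + d (Z c.1) (Z l.1) Y0.
      by apply: (prD lsT); neq.
    have : d (Z l.1) X (Z c.1) <= theta by apply: (prB lsT); try neq; nlia.
    have : d (Z l.1) X Y0 <= d (Z l.1) X (Z c.1) + d (Z l.1) (Z c.1) Y0.
      by apply: (prD lsT); neq.
    by nlia.
  - by rewrite /x big_cons (es_actM lsT) -/(x _) xW.
move=> w1; exists h; have : fg_word w != [::].
  by apply/eqP => w0; apply: w1; apply/val_inj.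
rewrite /word_map -/(x _); case: (fg_word w) (fg_reduced w) => // l s ls _.
have [n [W [WZ dW ->]]] := main l s ls.
have [XZ] := dV l n W WZ dW; set X := act _ W => dX.
apply: contraTneq dX => ->; rewrite -leqNgt.
by apply: leq_trans (prxx lsT _) _; rewrite 1?eq_sym//; nlia.
Qed.

End FreeSubgroup.
End Pingpong.

(** * Chains *)

Section Chain.
Variables (T : choiceType) (d : T -> T -> T -> nat) (theta : nat).
Local Open Scope nat_scope.
Hypothesis prT : projection_system d theta.

Record chain (L n : nat) (Z : nat -> T) : Prop := Chain {
  chain_neq : forall j, j < n -> Z j != Z j.+1;
  chain_far : forall j, j.+2 <= n -> L < d (Z j.+1) (Z j) (Z j.+2) }.

Lemma chain_shift L n Z i : i <= n -> chain L n Z ->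
  chain L (n - i) (fun j => Z (i + j)).
Proof.
move=> i_n [Zn Zf]; split=> j jn; rewrite ?addnS; first by apply: Zn; lia.
by apply: Zf; lia.
Qed.

Lemma chain_rev L n Z : chain L n Z -> chain L n (fun j => Z (n - j)).
Proof.
move=> [Zn Zf]; split=> j jn.
  have -> : n - j = (n - j.+1).+1 by lia.
  by rewrite eq_sym; apply: Zn; lia.
have -> : n - j = (n - j.+2).+2 by lia.
have -> : n - j.+1 = (n - j.+2).+1 by lia.
by rewrite (prC prT); apply: Zf; lia.
Qed.

(** Local conditions become global without accumulating loss: by the Behrstock inequality [Z 0] and
    the preceding point look alike from each new point. *)
Lemma chain_start L n Z j : 3 * theta <= L -> chain L n Z -> j < n ->
  Z 0 != Z j.+1 /\ (j.+2 <= n -> L - theta < d (Z j.+1) (Z 0) (Z j.+2)).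
Proof.
move=> tL [Zn Zf]; elim: j => [|j IH] jn.
  by split=> [|n2]; [exact: Zn|have := Zf _ n2; lia].
have [Z0j /(_ jn) dj] := IH (ltnW jn).
have Zj := Zn _ jn.
have Z0j2 : Z 0 != Z j.+2.
  by apply: contraTneq dj => ->; rewrite -leqNgt;
    apply: leq_trans (prxx prT _) _; try neq; lia.
split=> // jn2; have := Zf _ jn2; have Zj2 := Zn _ jn2.
have dj2 : d (Z j.+2) (Z 0) (Z j.+1) <= theta by apply: (prB prT); try neq; nlia.
have : d (Z j.+2) (Z j.+1) (Z j.+3) <=
    d (Z j.+2) (Z j.+1) (Z 0) + d (Z j.+2) (Z 0) (Z j.+3) by apply: (prD prT); neq.
by rewrite [d _ (Z j.+1) (Z 0)](prC prT); nlia.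
Qed.

Lemma chain_inj L n Z i j : 3 * theta <= L -> chain L n Z -> i < j <= n -> Z i != Z j.
Proof.
move=> tL cZ /andP[ij jn]; have i_n : i <= n by lia.
have [|+ _] := chain_start (j := j - i.+1) tL (chain_shift i_n cZ); first by lia.
by rewrite addn0; have -> : i + (j - i.+1).+1 = j by lia.
Qed.

Lemma chain_near L n Z j : 3 * theta <= L -> chain L n Z -> j < n ->
  d (Z j.+1) (Z 0) (Z j) <= theta.
Proof.
move=> tL cZ; case: j => [|j] jn; first by apply: (prxx prT); exact: (chain_neq cZ).
have [Z0j2 _] := chain_start tL cZ jn.
have [Z0j /(_ jn) dj] := chain_start tL cZ (ltnW jn).
by apply: (prB prT); try neq; [exact: chain_neq cZ _ jn|nlia].
Qed.

Lemma chain_near_end L n Z j : 3 * theta <= L -> chain L n Z -> j < n ->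
  d (Z j) (Z n) (Z j.+1) <= theta.
Proof.
move=> tL cZ jn; have := chain_near (j := n - j.+1) tL (chain_rev cZ).
rewrite subn0; have -> : n - (n - j.+1).+1 = j by lia.
have -> : n - (n - j.+1) = j.+1 by lia.
by apply; lia.
Qed.

Lemma chain_ends L n Z j : 3 * theta <= L -> chain L n Z -> j.+1 < n ->
  L - 2 * theta < d (Z j.+1) (Z 0) (Z n) /\
  d (Z j.+1) (Z 0) (Z n) <= d (Z j.+1) (Z j) (Z j.+2) + 2 * theta.
Proof.
move=> tL cZ jn; have [Z0 dj] := chain_start tL cZ (ltnW jn).
have Zn : Z n != Z j.+1 by rewrite eq_sym; apply: (chain_inj tL cZ); lia.
have Z1 := chain_neq cZ (ltnW jn); have Z2 := chain_neq cZ jn.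
have d1 := chain_near tL cZ (ltnW jn); have d2 := chain_near_end tL cZ jn.
have t1 : d (Z j.+1) (Z 0) (Z j.+2) <= d (Z j.+1) (Z 0) (Z n) + d (Z j.+1) (Z n) (Z j.+2).
  by apply: (prD prT); neq.
have t2 : d (Z j.+1) (Z 0) (Z n) <= d (Z j.+1) (Z 0) (Z j) + d (Z j.+1) (Z j) (Z n).
  by apply: (prD prT); neq.
have : d (Z j.+1) (Z j) (Z n) <= d (Z j.+1) (Z j) (Z j.+2) + d (Z j.+1) (Z j.+2) (Z n).
  by apply: (prD prT); neq.
by have := dj jn; rewrite [d _ (Z j.+2) (Z n)](prC prT); nlia.
Qed.

(** The point [Z j] separates [Z 0] from [Z j.+1], so the class in which the chain arrives at an
    axis depends on the last link only. *)
Lemma chain_conn Theta n Z j : 4 * theta <= Theta -> chain (Theta + theta) n Z -> j < n ->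
  conn d Theta (Z j.+1) (Z 0) (Z j).
Proof.
move=> tT cZ; case: j => [|j] jn; first exact: conn_refl.
have [|Z0j2 _] := chain_start _ cZ jn; first by lia.
have [|Z0j /(_ jn) dj] := chain_start _ cZ (ltnW jn); first by lia.
apply: (conn_fwd (V := Z 0)); first exact: conn_refl.
rewrite /separates Z0j2 [_ == Z 0]eq_sym Z0j (chain_neq cZ jn) /=; lia.
Qed.

Lemma chain_conn_end Theta n Z j : 4 * theta <= Theta -> chain (Theta + theta) n Z ->
  j < n -> conn d Theta (Z j) (Z n) (Z j.+1).
Proof.
move=> tT cZ jn; have := chain_conn (j := n - j.+1) tT (chain_rev cZ).
rewrite subn0; have -> : n - (n - j.+1).+1 = j by lia.
have -> : n - (n - j.+1) = j.+1 by lia.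
by apply; lia.
Qed.

(** Once the projection to [Y] leaves the vicinity of that of [Z 0], at some [Z j.+1], the Behrstock
    inequality at [Z j.+1] keeps the end [Z n] close to [Z j.+1] as seen from [Y]. So at most one
    link, of size [S], contributes. *)
Lemma chain_off L n Z Y S : 4 * theta <= L -> chain L n Z ->
    (forall j, j <= n -> Y != Z j) ->
    (forall j, j < n -> d Y (Z j) (Z j.+1) <= S) ->
  d Y (Z 0) (Z n) <= S + 2 * theta.
Proof.
move=> tL cZ YZ ZS; have tL3 : 3 * theta <= L by lia.
have [//|bad] := leqP (d Y (Z 0) (Z n)) (S + 2 * theta).
have near j : j <= n -> d Y (Z 0) (Z j) <= theta.
  elim: j => [_|j IH jn]; first by apply: (prxx prT); rewrite eq_sym YZ.
  have {}IH := IH (ltnW jn); have dS := ZS _ jn.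
  have [//|far] := leqP (d Y (Z 0) (Z j.+1)) theta.
  have Y0 := YZ _ (leq0n n); have Yj := YZ _ (ltnW jn); have Yj1 := YZ _ jn.
  have Yn := YZ _ (leqnn n).
  have t0 : d Y (Z 0) (Z j.+1) <= d Y (Z 0) (Z j) + d Y (Z j) (Z j.+1).
    by apply: (prD prT); neq.
  have [jn1|jn1] := eqVneq j.+1 n; first by rewrite -jn1 in bad; nlia.
  have {}jn1 : j.+1 < n by rewrite ltn_neqAle jn1.
  have Z0j : Z 0 != Z j.+1 by apply: (chain_inj tL3 cZ).
  have Znj : Z j.+1 != Z n by apply: (chain_inj tL3 cZ); rewrite jn1 leqnn.
  have [e1 _] := chain_ends tL3 cZ jn1.
  have e2 : d (Z j.+1) (Z 0) Y <= theta by apply: (prB prT); neq.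
  have e3 : d (Z j.+1) (Z 0) (Z n) <= d (Z j.+1) (Z 0) Y + d (Z j.+1) Y (Z n).
    by apply: (prD prT); neq.
  have e4 : d Y (Z n) (Z j.+1) <= theta.
    by apply: (prB prT); try neq; rewrite (prC prT); nlia.
  have : d Y (Z 0) (Z n) <= d Y (Z 0) (Z j.+1) + d Y (Z j.+1) (Z n).
    by apply: (prD prT); neq.
  by rewrite [d Y (Z j.+1) _](prC prT); nlia.
by have := near n (leqnn n); nlia.
Qed.

End Chain.

(** * A product that crosses each pattern once *)

Section Assembly.
Variables (G : groupType) (T : choiceType) (act : G -> T -> T).
Variables (d : T -> T -> T -> nat) (theta : nat) (Y0 : T).
Variables (b b' v beta : G) (alpha : nat -> G) (Theta S m : nat).
Local Open Scope nat_scope.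

Let syllables := [:: b; v; b^-1 * b'; b'^-1; b^-1]%g.
Let P := act b' Y0.
Let Q (i : 'I_m) := act (alpha i * b)%g Y0.

Hypothesis esT : equivariant_system act d theta.
Hypothesis ThetaP : 4 * theta <= Theta.
Hypothesis betaY0 : fixes act beta Y0.
Hypothesis alphaY0 : forall i, fixes act (alpha i) Y0.
Hypothesis sylY0 : forall s, s \in syllables -> act s Y0 != Y0.
Hypothesis sylS : forall s Y, s \in syllables -> Y != Y0 -> Y != act s Y0 ->
  d Y Y0 (act s Y0) <= S.
(** The lower bound makes these links part of a chain; the upper bound keeps them too short for a
    crossing, whose length exceeds [S + 4 * theta] by [alphaP]. *)
Hypothesis betaP : forall s s' be, s \in syllables -> s' \in syllables ->
  be \in [:: beta; beta^-1%g] ->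
  Theta + theta < d Y0 (act s^-1%g Y0) (act (be * s')%g Y0) <= S.
Hypothesis alphaP : forall i, 2 * Theta + 8 * theta + S < d Y0 P (act (alpha i * b)%g Y0).
Hypothesis alpha_sparse : forall i j, i < j ->
  d Y0 P (act (alpha i * b)%g Y0) + 8 * theta < d Y0 P (act (alpha j * b)%g Y0).
Hypothesis alphaV : forall i,
  Theta + theta < d Y0 (act b Y0) (act ((alpha i)^-1 * b)%g Y0).
Hypothesis bb'_inequiv : forall h, act h Y0 = Y0 ->
  ~ conn d Theta Y0 P (act (h * b)%g Y0).

(** Syllables move [Y0], turns fix it, and the turn after syllable [t] takes place at the axis
    [Z t.+1]. With [u x = x * beta * v * beta^-1 * x^-1], a period of eight reads [u b * u b' *
    (alpha i * u b * (alpha i)^-1)], a product of three conjugates of [v]. *)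
Definition syl t := nth 1%g [:: b; v; b^-1 * b'; v; b'^-1; b; v; b^-1]%g (t %% 8).
Definition turn t := nth 1%g [:: beta; beta^-1; beta; beta^-1; alpha (t %/ 8);
  beta; beta^-1; (alpha (t %/ 8))^-1]%g (t %% 8).

Fixpoint prefix t : G := if t is t'.+1 then (prefix t' * syl t' * turn t')%g else 1%g.

Let Z t := act (prefix t) Y0.

Lemma sylE i r : syl (8 * i + r) = syl r.
Proof. by rewrite /syl mulnC modnMDl. Qed.

Lemma turnE i r : r < 8 -> turn (8 * i + r) = nth 1%g [:: beta; beta^-1; beta; beta^-1; alpha i;
  beta; beta^-1; (alpha i)^-1]%g r.
Proof. by move=> r8; rewrite /turn mulnC modnMDl divnMDl// divn_small// modn_small// addn0. Qed.

Lemma syl_mem t : syl t \in syllables.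
Proof.
rewrite /syl /syllables; have := ltn_pmod t (isT : 0 < 8).
by case: (t %% 8) => [|[|[|[|[|[|[|[|//]]]]]]]] _; rewrite !inE eqxx ?orbT.
Qed.

Lemma turnY0 t : act (turn t) Y0 = Y0.
Proof.
have bV := fixesV esT betaY0; have aV := fixesV esT (alphaY0 (t %/ 8)).
rewrite /turn; have := ltn_pmod t (isT : 0 < 8).
by case: (t %% 8) => [|[|[|[|[|[|[|[|//]]]]]]]] _ /=; rewrite ?betaY0 ?bV ?alphaY0 ?aV.
Qed.

Lemma step_next t : Z t.+1 = act (prefix t * syl t)%g Y0.
Proof. by rewrite /Z /= (es_actM esT) turnY0. Qed.

Lemma step_prev t : Z t = act (prefix t.+1 * (turn t)^-1 * (syl t)^-1)%g Y0.
Proof. by rewrite /Z /= !mulgK. Qed.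

Lemma d_link t : d (Z t.+1) (Z t) (Z t.+2) =
  d Y0 (act (syl t)^-1%g Y0) (act (turn t * syl t.+1)%g Y0).
Proof.
have tY0 : act (turn t)^-1%g Y0 = Y0 := fixesV esT (turnY0 t).
rewrite -[RHS](es_equiv esT (prefix t.+1 * (turn t)^-1)%g) -!(es_actM esT).
rewrite -step_prev; congr (d _ _ _); first by rewrite [RHS](es_actM esT) tY0.
by rewrite step_next !mulgA mulgVK.
Qed.

(* Positions [4] and [7] of each period carry the long turns [alpha i]. *)
Lemma turn_cases t : exists i r, r < 8 /\ t = 8 * i + r /\
  [\/ r = 4, r = 7 | turn t \in [:: beta; beta^-1%g]].
Proof.
exists (t %/ 8), (t %% 8); split; first exact: ltn_pmod.
split; first by rewrite mulnC -divn_eq.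
rewrite /turn; have := ltn_pmod t (isT : 0 < 8).
case: (t %% 8) => [|[|[|[|[|[|[|[|//]]]]]]]] _; rewrite ?inE ?eqxx ?orbT;
  by [constructor 1|constructor 2|constructor 3].
Qed.

Lemma link_alpha i : d (Z (8 * i + 4).+1) (Z (8 * i + 4)) (Z (8 * i + 4).+2) =
  d Y0 P (act (alpha i * b)%g Y0).
Proof. by rewrite d_link -addnS turnE// !sylE /syl /= invgK. Qed.

Lemma link_alphaV i : d (Z (8 * i + 7).+1) (Z (8 * i + 7)) (Z (8 * i + 7).+2) =
  d Y0 (act b Y0) (act ((alpha i)^-1 * b)%g Y0).
Proof. by rewrite d_link -addnS turnE// !sylE /syl /= invgK. Qed.

Lemma assembly_chain n : chain d (Theta + theta) n Z.
Proof.
split=> j _.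
  rewrite /Z /= !(es_actM esT) turnY0 (act_eq esT) eq_sym; exact/sylY0/syl_mem.
have [i [r [r8 [-> [->|->|tb]]]]] := turn_cases j.
- by rewrite link_alpha; have := alphaP i; lia.
- by rewrite link_alphaV; exact: alphaV.
by rewrite d_link; have /andP[] := betaP (syl_mem (8 * i + r)) (syl_mem (8 * i + r).+1) tb.
Qed.

(** Classes are taken up to the stabilizer of [Y], which absorbs the turns: a crossing of any type
    goes from a [b']-class to a [b]-class. *)
Let class_b Y X := exists g, act g Y0 = Y /\ conn d Theta Y X (act (g * b)%g Y0).
Let class_b' Y X := exists g, act g Y0 = Y /\ conn d Theta Y X (act (g * b')%g Y0).

Lemma class_disj Y X : class_b Y X -> class_b' Y X -> False.
Proof.
move=> [g [gY Xgb]] [h [hY Xhb']].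
have := conn_trans (conn_sym Xhb') Xgb.
move=> /(conn_act esT h^-1%g); rewrite -hY (actK esT) -!(es_actM esT) mulKg mulgA.
by apply: bb'_inequiv; rewrite (es_actM esT) gY -hY (actK esT).
Qed.

Let crossing := crossing act d Theta Y0 P Q.

Lemma crossing_class i Y X X' : crossing i Y X X' -> class_b' Y X /\ class_b Y X'.
Proof.
move=> [_ _ [g [gY XP XQ]]]; split.
  by exists g; rewrite (es_actM esT).
exists (g * alpha i)%g; rewrite (es_actM esT) alphaY0; split=> //.
by rewrite -mulgA (es_actM esT).
Qed.

Lemma turn_pre_fix t : act (prefix t.+1 * (turn t)^-1)%g Y0 = Z t.+1.
Proof. by rewrite (es_actM esT) (fixesV esT (turnY0 t)). Qed.

Lemma class_prev_b' t n : t < n -> syl t = b'^-1%g -> class_b' (Z t.+1) (Z 0).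
Proof.
move=> tn st; exists (prefix t.+1 * (turn t)^-1)%g; split; first exact: turn_pre_fix.
rewrite -[b']invgK -st -step_prev.
exact: (chain_conn esT ThetaP (assembly_chain n)).
Qed.

Lemma class_prev_b t n : t < n -> syl t = b^-1%g -> class_b (Z t.+1) (Z 0).
Proof.
move=> tn st; exists (prefix t.+1 * (turn t)^-1)%g; split; first exact: turn_pre_fix.
rewrite -[b]invgK -st -step_prev.
exact: (chain_conn esT ThetaP (assembly_chain n)).
Qed.

Lemma class_next_b t n : t.+1 < n -> syl t.+1 = b -> class_b (Z t.+1) (Z n).
Proof.
move=> tn st; exists (prefix t.+1); split=> //; rewrite -st -step_next.
exact: (chain_conn_end esT ThetaP (assembly_chain n)).
Qed.

Lemma crossing_long i Y X X' : crossing i Y X X' -> S + 4 * theta < d Y X X'.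
Proof.
move=> cr; have PY0 : P != Y0.
  have : b'^-1%g \in syllables by rewrite /syllables !inE eqxx !orbT.
  by move=> /sylY0; rewrite (act_neq esT) invgK.
have QY0 j : Q j != Y0.
  rewrite /Q (es_actM esT) -{2}(alphaY0 j) (act_eq esT); apply: sylY0.
  by rewrite /syllables !inE eqxx.
have [_] := crossing_pr esT ThetaP PY0 QY0 cr; have := alphaP i; rewrite -/(Q i); lia.
Qed.

Lemma link_bound t Y : Y != Z t -> Y != Z t.+1 -> d Y (Z t) (Z t.+1) <= S.
Proof.
move=> Yt Yt1; rewrite -(es_equiv esT (prefix t)^-1%g) (actK esT).
rewrite step_next -!(es_actM esT) mulKg; apply: (sylS (syl_mem t)).
  by rewrite -(act_eq esT (prefix t)) (actVK esT).
by rewrite -(act_eq esT (prefix t)) (actVK esT) -(es_actM esT) -step_next.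
Qed.

(** A crossing is too long to occur off the chain or at a short turn. At an inverse turn both ends
    are in [b]-classes; at [alpha j] the passage is a crossing of type [j], in the positive
    direction only, and the type determines [j]. *)
Lemma assembly_count (i : 'I_m) :
  cross_count act d Theta Y0 P Q i Y0 (act (prefix (8 * m)) Y0) = 1%R.
Proof.
pose n := 8 * m; have cZ := assembly_chain n.
have tL : 4 * theta <= Theta + theta by lia.
have tL3 : 3 * theta <= Theta + theta by lia.
have PY0 : P != Y0.
  have : b'^-1%g \in syllables by rewrite /syllables !inE eqxx !orbT.
  by move=> /sylY0; rewrite (act_neq esT) invgK.
have QY0 j : Q j != Y0.
  rewrite /Q (es_actM esT) -{2}(alphaY0 j) (act_eq esT); apply: sylY0.
  by rewrite /syllables !inE eqxx.
have at4 j : j < m -> class_b' (Z (8 * j + 4).+1) (Z 0) /\ class_b (Z (8 * j + 4).+1) (Z n).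
  move=> jm; split; first by apply: (@class_prev_b' _ n); [rewrite /n; lia|rewrite sylE].
  by apply: class_next_b; [rewrite /n; lia|rewrite -addnS sylE].
have at7 j : (8 * j + 7).+1 < n ->
    class_b (Z (8 * j + 7).+1) (Z 0) /\ class_b (Z (8 * j + 7).+1) (Z n).
  move=> jm; split; first by apply: (@class_prev_b _ n); [lia|rewrite sylE].
  by apply: class_next_b; [lia|rewrite -addnS sylE].
have cross4 (j : 'I_m) : crossing j (Z (8 * j + 4).+1) (Z 0) (Z n).
  have jm := ltn_ord j; split.
  - by apply: (chain_inj esT tL3 cZ); rewrite /n; lia.
  - by rewrite eq_sym; apply: (chain_inj esT tL3 cZ); rewrite /n; lia.
  exists (prefix (8 * j + 4).+1 * (turn (8 * j + 4))^-1)%g; split.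
  - exact: turn_pre_fix.
  - rewrite -(es_actM esT); have -> : b' = (syl (8 * j + 4))^-1%g by rewrite sylE /syl invgK.
    by rewrite -step_prev; apply: (chain_conn esT ThetaP cZ); rewrite /n; lia.
  - have -> : turn (8 * j + 4) = alpha j by rewrite turnE.
    rewrite -(es_actM esT) -mulgA mulKg.
    have -> : b = syl (8 * j + 4).+1 by rewrite -addnS sylE.
    by rewrite -step_next; apply: (chain_conn_end esT ThetaP cZ); rewrite /n; lia.
have cross_at Y X X' : crossing i Y X X' \/ crossing i Y X' X -> X = Z 0 -> X' = Z n ->
    exists j : 'I_m, Y = Z (8 * j + 4).+1.
  move=> cr X0 Xn; have dY : S + 4 * theta < d Y (Z 0) (Z n).
    by case: cr => /crossing_long; rewrite X0 Xn // (prC esT).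
  have [Y0' Yn] : Y != Z 0 /\ Y != Z n.
    by rewrite -X0 -Xn; case: cr => -[? ? _]; split; neq.
  have [t [tn Yt]] : exists t, t <= n /\ Y = Z t.
    have [//|no] := pselect (exists t, t <= n /\ Y = Z t).
    have : d Y (Z 0) (Z n) <= S + 2 * theta.
      have YZ t : t <= n -> Y != Z t by move=> tn; apply/eqP => YZ; apply: no; exists t.
      apply: (chain_off esT tL cZ) => // t tn.
      by apply: link_bound; apply: YZ => //; exact: ltnW.
    by nlia.
  case: t => [|t] in tn Yt; first by rewrite Yt eqxx in Y0'.
  have {}tn : t.+1 < n.
    by rewrite ltn_neqAle tn andbT; apply: contraNneq Yn => <-; rewrite Yt.
  have [j [r [r8 [tE tc]]]] := turn_cases t.
  have jm : j < m by move: tn; rewrite tE /n; lia.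
  case: tc => [r4|r7|tb].
  - by exists (Ordinal jm); rewrite Yt tE r4.
  - rewrite r7 in tE; have [c0 cn] : class_b Y (Z 0) /\ class_b Y (Z n).
      by rewrite Yt tE; apply: at7; rewrite -tE.
    case: cr => /crossing_class[+ _]; rewrite ?X0 ?Xn => cb.
      by case: (class_disj c0 cb).
    by case: (class_disj cn cb).
  - have [_] := chain_ends esT tL3 cZ tn; rewrite d_link -Yt.
    have /andP[_] := betaP (syl_mem t) (syl_mem t.+1) tb.
    by move: dY; move: (d Y _ _) (d Y0 _ _) => x y; nlia.
have Z0E : Y0 = Z 0 by rewrite /Z /= (es_act1 esT).
have -> : cross_count act d Theta Y0 P Q i Y0 (act (prefix (8 * m)) Y0) =
    cross_count act d Theta Y0 P Q i (Z 0) (Z n) by rewrite -Z0E.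
rewrite /cross_count; transitivity (\sum_(Y \in [set Z (8 * i + 4).+1])
    signed_cross act d Theta Y0 P Q i Y (Z 0) (Z n))%R.
  apply: esym; apply: fsbig_widen => // Y [_ YZ] /=; apply/eqP/negPn/negP.
  move=> /signed_cross_neq0 cr.
  have [j Yj] := cross_at Y (Z 0) (Z n) cr erefl erefl.
  have [c0 cn] := at4 j (ltn_ord j); rewrite -Yj in c0 cn.
  case: cr => [cr|/crossing_class[cb _]]; last exact: class_disj cn cb.
  have := cross4 j; rewrite -Yj => cr'; apply: YZ.
  have sparse (k l : 'I_m) : k < l -> d Y0 P (Q k) + 8 * theta < d Y0 P (Q l).
    exact: alpha_sparse.
  by rewrite /= Yj (crossing_inj esT ThetaP PY0 QY0 sparse cr' cr).
rewrite fsbig_set1 /signed_cross /ncross asboolT; last exact: cross4.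
rewrite asboolF// => /crossing_class[cb _].
by have [_ cn] := at4 i (ltn_ord i); exact: class_disj cn cb.
Qed.

End Assembly.

(** * Verbal subgroups of groups acting on a projection system *)

Section VerbalSubgroup.
Variables (G : groupType) (k : nat) (w : free_group k).

Lemma word_map_conj (x : G) (g : 'I_k -> G) :
  word_map w (fun i => x * g i * x^-1)%g = (x * word_map w g * x^-1)%g.
Proof.
rewrite /word_map; elim: (fg_word w) => [|a s IH]; first by rewrite !big_nil mulg1 mulgV.
rewrite !big_cons {}IH; have -> : letter_eval (fun i => x * g i * x^-1)%g a =
    (x * letter_eval g a * x^-1)%g.
  by rewrite /letter_eval; case: a.2 => //; rewrite !invgM invgK mulgA.
by rewrite !mulgA mulgVK.
Qed.

Lemma verbal_subgroup1 : verbal_subgroup (G := G) w 1%g.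
Proof. by move=> H [[]]. Qed.

Lemma verbal_subgroupM (x y : G) :
  verbal_subgroup w x -> verbal_subgroup w y -> verbal_subgroup w (x * y)%g.
Proof.
move=> wx wy H HP; have [[H1 HV] _] := HP.
rewrite -[y]invgK; apply: (HV); first exact: wx.
by rewrite -[y^-1%g]mul1g; apply: (HV) => //; exact: wy.
Qed.

Lemma verbal_subgroup_word_map (g : 'I_k -> G) : verbal_subgroup w (word_map w g).
Proof. by move=> H [_]; apply; exists g. Qed.

Lemma verbal_productP (x : G) : verbal_subgroup w x -> exists n, verbal_product w x n.
Proof.
move=> wx; apply: (wx [set x | exists n, verbal_product w x n]); split; last first.
  move=> y wy; exists 1%N, [tuple y]; split; last by rewrite big_seq1.
  by move=> z; rewrite inE => /eqP ->; left.
split; first by exists 0%N, [tuple]; rewrite big_nil.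
move=> y z [n1 [s1 [s1w ->]]] [n2 [s2 [s2w ->]]].
exists (n1 + n2)%N, (cat_tuple s1 (map_tuple (fun u : G => u^-1)%g (rev_tuple s2))); split.
  move=> u; rewrite mem_cat => /orP[/s1w//|/mapP[u' + ->]].
  by rewrite mem_rev invgK => /s2w [|]; [right|left].
rewrite big_cat big_map /=; congr (_ * _)%g.
elim: (tval s2) => [|u s IH]; first by rewrite !big_nil invg1.
by rewrite big_cons rev_cons big_rcons /= invgM IH.
Qed.

End VerbalSubgroup.

Section Main.
Variables (G : groupType) (T : choiceType) (act : G -> T -> T).
Variables (d : T -> T -> T -> nat) (theta : nat) (Y0 : T) (f b : G).
Local Open Scope nat_scope.
Hypothesis lsT : loxodromic_system act d theta Y0 f b.

Lemma pr_bounded_seq (l : seq T) : exists S, forall X Y, X \in l ->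
  Y != Y0 -> Y != X -> d Y Y0 X <= S.
Proof.
elim: l => [|Z l [S SP]]; first by exists 0.
have [S' S'P] := pr_bounded lsT Y0 Z; exists (maxn S S') => X Y.
rewrite inE leq_max => /orP[/eqP -> YY YX|Xl YY YX]; first by rewrite S'P ?orbT.
by rewrite SP.
Qed.

Lemma bounded_seq (I : eqType) (l : seq I) (F : I -> nat) :
  exists S, forall x, x \in l -> F x <= S.
Proof. by exists (\max_(x <- l) F x) => x xl; exact: leq_bigmax_seq. Qed.

(* [b'] lies in another double coset of the stabilizer of [Y0] than [b]: the
   largest projection [d Y Y0 (act g Y0)] only depends on the double coset. *)
Lemma second_double_coset : exists b', [/\ act b' Y0 != Y0, act b' Y0 != act b Y0 &
  forall h, act h Y0 = Y0 -> act b' Y0 != act (h * b)%g Y0].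
Proof.
have bY0 := ls_move lsT.
have bVY0 : act b^-1%g Y0 != Y0 by rewrite -(act_neq lsT).
have [S SP] := pr_bounded lsT Y0 (act b Y0).
have [N NP] := ls_translate lsT (S + theta).+1 bVY0 bY0.
(* The axis [b Y0] lies between [Y0] and [b' Y0], where [N] makes the projection larger than any
   seen between [Y0] and a translate of [b Y0] by the stabilizer. *)
pose b' := (b * f ^+ N * b)%g.
have far : S + theta < d (act b Y0) Y0 (act b' Y0).
  by rewrite -(es_equiv lsT b^-1%g) (actK lsT) -(es_actM lsT) /b' -mulgA mulKg (es_actM lsT) NP.
have b'b : act b' Y0 != act b Y0.
  rewrite /b' -mulgA (es_actM lsT) (act_eq lsT).
  by rewrite -{2}(fixesX lsT N (ls_fix lsT)) (es_actM lsT) (act_eq lsT).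
exists b'; split=> //.
  apply: contraTneq far => ->; rewrite -leqNgt.
  by apply: leq_trans (prxx lsT _) _; [neq|lia].
move=> h hY0; apply: contraTneq far => b'E; rewrite -leqNgt b'E.
have hbb : act h^-1%g (act b Y0) != act b Y0.
  apply: contraNneq b'b => hb; rewrite b'E (es_actM lsT) -{1}hb (actVK lsT)//.
have hVY0 : act h^-1%g Y0 = Y0 := fixesV lsT hY0.
rewrite -(es_equiv lsT h^-1%g) hVY0 -!(es_actM lsT) mulKg.
rewrite (es_actM lsT); apply: leq_trans (SP _ _ _) _ => //; last by lia.
by rewrite -{2}hVY0 (act_eq lsT).
Qed.

Variables (k : nat) (w : free_group k).

(** The order of the choices is forced: [Theta] depends on [b] and [b'], [beta] on [Theta], the
    bound [S] on [beta], and the turns [alpha i] on [S] and on their predecessors. *)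
Lemma verbal_product_unbounded : w <> 1%g -> exponent_gcd w <> 1 ->
  forall n, exists g : G, verbal_subgroup w g /\ forall j, verbal_product w g j -> n < j.
Proof.
move=> w1 ew1 n.
have bY0 := ls_move lsT; have fixf N := fixesX lsT N (ls_fix lsT).
have [gv vY0] := pingpong lsT w1.
have [b' [b'Y0 b'b bb']] := second_double_coset.
pose v := word_map w gv; rewrite -/v in vY0.
pose syllables := [:: b; v; b^-1 * b'; b'^-1; b^-1]%g.
have sylY0 s : s \in syllables -> act s Y0 != Y0.
  rewrite !inE => /or4P[/eqP->|/eqP->|/eqP->|/orP[/eqP->|/eqP->]] //;
    try by rewrite -(act_neq lsT).
  by rewrite (es_actM lsT) -(act_eq lsT b) (actVK lsT).
have [S1 S1P] := pr_bounded_seq (map (act^~ Y0) syllables).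
have [S2 S2P] := pr_bounded_seq [:: act b Y0; act b' Y0].
(* The summand [S2] ensures that nothing separates [b' Y0] or a translate of [b Y0] by the
   stabilizer from [Y0], so that their classes differ. *)
pose Theta := 4 * theta + S2.
have ThetaP : 4 * theta <= Theta by rewrite /Theta; lia.
have inequiv h : act h Y0 = Y0 -> ~ conn d Theta Y0 (act b' Y0) (act (h * b)%g Y0).
  move=> hY0 /(conn_unseparated lsT ThetaP) eqb.
  have /eqP := bb' h hY0; apply; apply: eqb => W WX WY.
    rewrite (prC lsT); apply: leq_trans (S2P _ _ _ WY WX) _; first by rewrite !inE eqxx orbT.
    by rewrite /Theta; lia.
  have hVY0 : act h^-1%g Y0 = Y0 := fixesV lsT hY0.
  rewrite (prC lsT) -(es_equiv lsT h^-1%g) hVY0 -(es_actM lsT) mulKg.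
  apply: leq_trans (S2P _ _ _ _ _) _; first by rewrite !inE eqxx.
  - by rewrite -hVY0 (act_eq lsT).
  - by rewrite -(act_eq lsT h) (actVK lsT) -(es_actM lsT).
  - by rewrite /Theta; lia.
pose pairs := [seq (s, s') | s <- syllables, s' <- syllables].
have pairsY0 p : p \in pairs -> (act p.1^-1%g Y0 != Y0) && (act p.2 Y0 != Y0).
  by case/allpairsP => -[s s'] /= [ss ss' ->] /=; rewrite -(act_neq lsT) !sylY0.
(* Both orders are listed because a turn by [beta^-1] is a turn by [beta] with the ends exchanged,
   by [betaV]. *)
pose turns := flatten
  [seq [:: (act p.1^-1%g Y0, act p.2 Y0); (act p.2 Y0, act p.1^-1%g Y0)] | p <- pairs].
have turnsY0 q : q \in turns -> (q.1 != Y0) && (q.2 != Y0).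
  move=> /flatten_mapP[p /pairsY0/andP[p1 p2]].
  by rewrite !inE => /orP[]/eqP -> /=; rewrite ?p1 ?p2.
have [N NP] := ls_translate_seq lsT (Theta + theta).+1 turnsY0.
pose beta := (f ^+ N)%g.
have betaV X Z : d Y0 X (act (beta^-1)%g Z) = d Y0 Z (act beta X).
  by rewrite (prC lsT) (d_act lsT) invgK fixf.
have [S3 S3P] := bounded_seq pairs
  (fun p => maxn (d Y0 (act p.1^-1%g Y0) (act (beta * p.2)%g Y0))
                 (d Y0 (act p.1^-1%g Y0) (act (beta^-1 * p.2)%g Y0))).
pose S := S1 + S3.
have betaP s s' be : s \in syllables -> s' \in syllables -> be \in [:: beta; beta^-1%g] ->
    Theta + theta < d Y0 (act s^-1%g Y0) (act (be * s')%g Y0) <= S.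
  move=> ss ss'; have pp : (s, s') \in pairs by apply: allpairs_f.
  have := S3P _ pp; rewrite geq_max /= => /andP[le1 le2].
  rewrite !inE => /orP[]/eqP ->; apply/andP; split;
    try by [exact: leq_trans le1 (leq_addl _ _)|exact: leq_trans le2 (leq_addl _ _)].
    rewrite (es_actM lsT); apply: (NP N (_, _)) => //.
    by apply/flatten_mapP; exists (s, s'); rewrite // !inE eqxx.
  rewrite (es_actM lsT) betaV; apply: (NP N (_, _)) => //.
  by apply/flatten_mapP; exists (s, s'); rewrite // !inE eqxx orbT.
pose D N := d Y0 (act b' Y0) (act (f ^+ N * b)%g Y0).
have /boolp.choice[pick pickP] : forall K, exists N, K < D N /\
    Theta + theta < d Y0 (act b Y0) (act ((f ^+ N)^-1 * b)%g Y0).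
  move=> K; have [N1 N1P] := ls_translate lsT K.+1 b'Y0 bY0.
  have [N2 N2P] := ls_translate lsT (Theta + theta).+1 bY0 bY0.
  exists (maxn N1 N2); rewrite /D (es_actM lsT); split; first exact: (N1P _ (leq_maxl _ _)).
  rewrite (es_actM lsT) (prC lsT) (d_act lsT) invgK fixf.
  exact: (N2P _ (leq_maxr _ _)).
pose K0 := 2 * Theta + 8 * theta + S.
pose NN := fix NN i := if i is i'.+1 then pick (K0 + D (NN i') + 8 * theta) else pick K0.
pose alpha i := (f ^+ NN i)%g.
have alphaV i : Theta + theta < d Y0 (act b Y0) (act ((alpha i)^-1 * b)%g Y0).
  rewrite /alpha; case: i => [|i] /=; first by case: (pickP K0).
  by case: (pickP (K0 + D (NN i) + 8 * theta)).
have alphaP i : K0 < D (NN i).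
  case: i => [|i] /=; first by case: (pickP K0).
  by have [] := pickP (K0 + D (NN i) + 8 * theta); lia.
have sparse i j : i < j -> D (NN i) + 8 * theta < D (NN j).
  elim: j => // j IH; rewrite ltnS leq_eqVlt => ij.
  have [far _] := pickP (K0 + D (NN j) + 8 * theta); rewrite -/(NN j.+1) in far.
  by case/orP: ij => [/eqP->|/IH]; lia.
(* One more index than [n] values of [w] can spoil. *)
pose m := (n * (36 * size w + 36)).+1.
pose g := prefix b b' v beta alpha (8 * m).
have esT : equivariant_system act d theta := lsT.
pose u x := (x * beta * v * beta^-1 * x^-1)%g.
have uE x : u x = word_map w (fun i => (x * beta) * gv i * (x * beta)^-1)%g.
  by rewrite word_map_conj /u invgM !mulgA.
have gE i : prefix b b' v beta alpha (8 * i + 8) =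
    (prefix b b' v beta alpha (8 * i) * (u b * u b' * (alpha i * u b * (alpha i)^-1)))%g.
  have pE l r : prefix b b' v beta alpha (l + r.+1) = (prefix b b' v beta alpha (l + r) *
      syl b b' v (l + r) * turn beta alpha (l + r))%g by rewrite addnS.
  by rewrite 8!pE !sylE !turnE// addn0 /u /syl /= !mulgA.
have wg i : verbal_subgroup w (prefix b b' v beta alpha (8 * i)).
  elim: i => [|i IH]; first by rewrite muln0; exact: verbal_subgroup1.
  rewrite mulnS addnC gE; apply: verbal_subgroupM => //; apply: verbal_subgroupM.
    by apply: verbal_subgroupM; rewrite uE; exact: verbal_subgroup_word_map.
  by rewrite uE -word_map_conj; exact: verbal_subgroup_word_map.
exists g; split; first exact: wg.
move=> j wj; rewrite ltnNge; apply/negP => jn.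
pose P := act b' Y0; pose Q (i : 'I_m) := act (alpha i * b)%g Y0.
pose q h i := cross_count act d Theta Y0 P Q i Y0 (act h Y0).
have QY0 i : Q i != Y0.
  by rewrite /Q (es_actM lsT) -{2}(fixf (NN i)) (act_eq lsT).
have dPQ i : 2 * Theta + 8 * theta < d Y0 P (Q i).
  by have := alphaP i; rewrite /K0 /D -/(alpha i) -/(Q i) -/P; lia.
have dsparse (i l : 'I_m) : i < l -> d Y0 P (Q i) + 8 * theta < d Y0 P (Q l).
  exact: sparse.
have qV h i : q h^-1%g i = (- q h i)%R.
  rewrite /q -(count_act esT _ _ _ _ i h) (actVK lsT).
  by rewrite (countC act d Theta Y0 P Q i).
have qM h h' : #|[set i | q (h * h')%g i != (q h i + q h' i)%R]%SET| <= 36.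
  have := count_cocycle esT ThetaP b'Y0 QY0 dPQ dsparse Y0 (act h Y0) (act (h * h')%g Y0).
  congr (_ <= _); apply: eq_card => i; rewrite !finset.inE /q.
  by rewrite (es_actM lsT) (count_act esT).
have := nondiv_product qV qM wj; rewrite leqNgt => /negP; apply.
have alphaY0 i : fixes act (alpha i) Y0 := fixf (NN i).
have S1P' s Y : s \in syllables -> Y != Y0 -> Y != act s Y0 -> d Y Y0 (act s Y0) <= S.
  move=> ss YY0 Ys; apply: leq_trans (S1P _ _ (map_f _ ss) YY0 Ys) _.
  exact: leq_addr.
have gcount := assembly_count esT ThetaP (fixf N) alphaY0 sylY0 S1P' betaP alphaP sparse
  alphaV inequiv.
suff -> : nondiv w (q g) = m by rewrite ltnS leq_mul2r jn orbT.
rewrite -[RHS](card_ord m); apply: eq_card => i; rewrite !finset.inE.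
rewrite /q /g gcount; apply/negP; rewrite dvdzE /= dvdn1 => /eqP; exact: ew1.
Qed.

End Main.

(** * Gromov products *)

Section IntegerPowers.
Local Open Scope ring_scope.
Variables (G : groupType) (f : G).

Definition zpow (n : int) : G :=
  match n with Posz n => (f ^+ n)%g | Negz n => ((f ^+ n.+1)^-1)%g end.

Lemma zpowS n : zpow (n + 1) = (zpow n * f)%g.
Proof.
case: n => [n|[|n]].
- by rewrite -PoszD addn1 /= expgSr.
- by rewrite /= expg1 mulVg.
have -> : (Negz n.+1 + 1 = Negz n)%R by lia.
by rewrite /= (expgS f n.+1) invgM mulgVK.
Qed.

Lemma zpowB n : zpow (n - 1) = (zpow n * f^-1)%g.
Proof. by rewrite -{2}(subrK 1%R n) zpowS mulgK. Qed.

Lemma zpowD m n : zpow (m + n) = (zpow m * zpow n)%g.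
Proof.
elim: n => [|n IH|n IH]; first by rewrite addr0 mulg1.
  have -> : (m + n.+1%:Z = m + n + 1)%R by lia.
  have -> : (n.+1%:Z = n%:Z + 1)%R by lia.
  by rewrite !zpowS IH mulgA.
have -> : (m - n.+1%:Z = m - n%:Z - 1)%R by lia.
have -> : (- n.+1%:Z = - n%:Z - 1)%R by lia.
by rewrite !zpowB IH mulgA.
Qed.

Lemma zpowN n : zpow (- n) = ((zpow n)^-1)%g.
Proof. by apply: (mulgI (zpow n)); rewrite -zpowD subrr mulgV. Qed.

Lemma zpowM n (q : nat) : zpow (n * q%:Z) = (zpow n ^+ q)%g.
Proof.
elim: q => [|q IH]; first by rewrite mulr0.
by rewrite intS mulrDr mulr1 zpowD IH expgS.
Qed.

End IntegerPowers.

Section GromovProduct.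
Local Open Scope ring_scope.
Variables (R : realType) (G : groupType) (D : G -> G -> R) (delta : R).

Definition gp a x y := (D a x + D a y - D x y) / 2.

Lemma gpE a x y : gp a x y = (D a x + D a y - D x y) / 2.
Proof. by []. Qed.

(** The space enters only through the left invariant pseudo-distance that an orbit induces on [G].
    The four point inequality is stated with a common lower bound [t] in place of a minimum. *)
Record hyperbolic_distance : Prop := HyperbolicDistance {
  dist_id : forall x, D x x = 0;
  dist_sym : forall x y, D x y = D y x;
  dist_triangle : forall x y z, D x z <= D x y + D y z;
  dist_inv : forall k x y, D (k * x)%g (k * y)%g = D x y;
  dist_delta : 0 <= delta;
  dist_hyp : forall a x y z t, t <= gp a x y -> t <= gp a y z ->
    t - delta <= gp a x z }.

Hypothesis hD : hyperbolic_distance.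

Lemma dist_ge0 x y : 0 <= D x y.
Proof. by have := dist_triangle hD x y x; rewrite (dist_id hD) (dist_sym hD y x); lra. Qed.

Lemma gpC a x y : gp a x y = gp a y x.
Proof. by rewrite /gp (dist_sym hD x y) [D a x + _]addrC. Qed.

Lemma gp_split a x y : gp a x y + gp x a y = D a x.
Proof. by rewrite /gp (dist_sym hD x a); lra. Qed.

Lemma gp_ge0 a x y : 0 <= gp a x y.
Proof. by rewrite /gp; have := dist_triangle hD x a y; rewrite (dist_sym hD x a); lra. Qed.

Lemma gp_lel a x y : gp a x y <= D a x.
Proof. by have := gp_split a x y; have := gp_ge0 x a y; lra. Qed.

Lemma gp_ler a x y : gp a x y <= D a y.
Proof. by rewrite gpC gp_lel. Qed.

Lemma gp_lipr a x y y' : gp a x y <= gp a x y' + D y y'.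
Proof.
rewrite /gp; have := dist_triangle hD a y' y; have := dist_triangle hD x y y'.
by rewrite (dist_sym hD y' y); lra.
Qed.

Lemma gp_lipl a x x' y : gp a x y <= gp a x' y + D x x'.
Proof. by rewrite gpC [gp a x' y]gpC gp_lipr. Qed.

Lemma gp_lip a a' x y : gp a x y <= gp a' x y + D a a'.
Proof.
by rewrite /gp; have := dist_triangle hD a a' x; have := dist_triangle hD a a' y; lra.
Qed.

Lemma gp_near a x y : D a x - D x y <= gp a x y.
Proof. by rewrite /gp; have := dist_triangle hD a y x; rewrite (dist_sym hD y x); lra. Qed.

Lemma gp_inv k a x y : gp (k * a)%g (k * x)%g (k * y)%g = gp a x y.
Proof. by rewrite /gp !(dist_inv hD). Qed.

Lemma gp_lt a x y z K : K + delta < gp a x y -> gp a x z <= K -> gp a y z <= K + delta.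
Proof.
move=> xy xz; rewrite leNgt; apply/negP => yz.
have xyz : K + delta < Num.min (gp a x y) (gp a y z) by rewrite lt_min xy yz.
have : Num.min (gp a x y) (gp a y z) - delta <= gp a x z.
  by apply: (dist_hyp hD (y := y)); rewrite ge_min lexx ?orbT.
lra.
Qed.

Lemma dist_mulVg x y : D 1%g (x^-1 * y)%g = D x y.
Proof. by rewrite -(dist_inv hD x) mulg1 mulVKg. Qed.

Lemma dist1V x : D 1%g (x^-1)%g = D 1%g x.
Proof. by rewrite -(mulg1 x^-1%g) dist_mulVg (dist_sym hD). Qed.

Section Quasiline.
Variables (a : nat -> G) (n : nat) (c s : R).
Hypothesis step : forall r, (r < n)%N -> D (a r) (a r.+1) <= s.
Hypothesis line : forall r, (r <= n)%N -> gp (a r) (a 0%N) (a n) <= c.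

Lemma quasiline_ivt t : 0 <= s -> 0 <= t <= D (a 0%N) (a n) ->
  exists2 r, (r <= n)%N & t <= D (a 0%N) (a r) <= t + s.
Proof.
move=> s0 /andP[t0 tn]; have : exists r, t <= D (a 0%N) (a r) by exists n.
move=> /ex_minnP[r tr rmin]; have rn := rmin _ tn; exists r => //; rewrite tr /=.
case: r => [|r] in tr rmin rn *; first by rewrite (dist_id hD); lra.
have : D (a 0%N) (a r) < t.
  by rewrite ltNge; apply/negP => /rmin; rewrite ltnn.
by have := step rn; have := dist_triangle hD (a 0%N) (a r) (a r.+1); lra.
Qed.

(** The witness is the vertex at distance about [gp (a 0) z (a n)] from [a 0], where the tripod of
    [z], [a 0] and [a n] branches. *)
Lemma quasiline_close z c1 : 0 <= s -> gp z (a 0%N) (a n) <= c1 ->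
  exists2 r, (r <= n)%N & D z (a r) <= c1 + s + 2 * c + 2 * delta.
Proof.
move=> s0 zc; pose t := gp (a 0%N) z (a n).
have [|r rn /andP[tr rt]] := quasiline_ivt (t := t) s0.
  by rewrite gp_ge0 gp_ler.
exists r => //.
have h1 : t - c <= gp (a 0%N) z (a n).
  by have := line rn; have := gp_ge0 (a r) (a 0%N) (a n); rewrite -/t; lra.
have h2 : t - c <= gp (a 0%N) (a n) (a r).
  have := gp_split (a 0%N) (a r) (a n); have := line rn.
  by rewrite [gp (a 0%N) (a n) _]gpC; lra.
have := dist_hyp hD h1 h2; have := gp_split (a 0%N) z (a n); rewrite -/t.
rewrite [gp (a 0%N) z (a r)]/gp (dist_sym hD (a 0%N) z); lra.
Qed.

End Quasiline.

End GromovProduct.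

(** * The axis of a loxodromic element *)

Section Axis.
Variables (R : realType) (G : groupType) (D : G -> G -> R) (delta : R).
Variables (f : G) (c : R).
Local Open Scope ring_scope.
Hypothesis hD : hyperbolic_distance D delta.
Local Notation gp := (gp D).
Local Notation fz := (zpow f).

(** The two conditions make the powers of [f] a quasi-geodesic: backtracking is bounded by [c], and
    the linear growth is normalised to rate 1. *)
Record is_axis : Prop := IsAxis {
  axis_line : forall i j k : int, i <= j <= k -> gp (fz j) (fz i) (fz k) <= c;
  axis_proper : forall n : int, `|n|%:~R <= D 1%g (fz n) }.

Hypothesis axf : is_axis.

Local Notation s := (D 1%g f).

(** A direction and a length, to treat both half-lines, and axes matched with opposite orientations,
    at once. *)
Definition sg (e : bool) (r : nat) : int := if e then - r%:Z else r%:Z.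

Lemma sgP (n : int) : exists e, n = sg e `|n|%N.
Proof. by case: n => n; [exists false|exists true; rewrite /sg NegzE abszN]. Qed.

Lemma axis_ge0 : 0 <= s. Proof. exact: dist_ge0 hD _ _. Qed.

Lemma axis_c : 0 <= c.
Proof. by apply: le_trans (gp_ge0 hD _ _ _) (axis_line axf (i := 0) (j := 0) (k := 0) _). Qed.

Lemma dist_fz i j : D (fz i) (fz j) = D 1%g (fz (j - i)).
Proof. by rewrite -(dist_mulVg hD) -zpowN -zpowD addrC. Qed.

Lemma dist_fzN n : D 1%g (fz (- n)) = D 1%g (fz n).
Proof. by rewrite zpowN (dist1V hD). Qed.

Lemma dist_sg e r : D 1%g (fz (sg e r)) = D 1%g (fz r%:Z).
Proof. by case: e; rewrite /sg ?dist_fzN. Qed.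

Lemma dist_fz_le (n : nat) : D 1%g (fz n%:Z) <= s * n%:R.
Proof.
elim: n => [|n IH]; first by rewrite mulr0 (dist_id hD).
rewrite (le_trans (dist_triangle hD _ (fz n%:Z) _))//.
rewrite dist_fz -natr1 mulrDr mulr1 lerD//.
by have -> : (n.+1%:Z - n%:Z)%R = 1%:Z by lia.
Qed.

Lemma dist_fz_ge (n : nat) : n%:R <= D 1%g (fz n%:Z).
Proof. exact: (axis_proper axf n%:Z). Qed.

Lemma ray_step x k e r : D (x * fz (k + sg e r))%g (x * fz (k + sg e r.+1))%g <= s.
Proof.
rewrite (dist_inv hD) dist_fz.
have -> : (k + sg e r.+1 - (k + sg e r) = sg e 1)%R by rewrite /sg; case: e; lia.
by rewrite dist_sg.
Qed.

Lemma ray_line x k e n r : (r <= n)%N ->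
  gp (x * fz (k + sg e r))%g (x * fz (k + sg e 0))%g (x * fz (k + sg e n))%g <= c.
Proof.
move=> rn; rewrite (gp_inv hD); case: e; last by apply: (axis_line axf); rewrite /sg; lia.
by rewrite (gpC hD); apply: (axis_line axf); rewrite /sg; lia.
Qed.

Lemma axis_close z x i j c1 : gp z (x * fz i)%g (x * fz j)%g <= c1 ->
  exists k, D z (x * fz k)%g <= c1 + s + 2 * c + 2 * delta.
Proof.
move=> zc; have [e ije] := sgP (j - i).
have zn : gp z (x * fz (i + sg e 0))%g (x * fz (i + sg e `|j - i|%N))%g <= c1.
  have -> : (i + sg e 0 = i)%R by rewrite /sg; case: e {ije}; rewrite ?oppr0 addr0.
  by rewrite -ije addrC subrK.
have [r _ rP] := quasiline_close hD (a := fun r => (x * fz (i + sg e r))%g)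
  (fun r _ => ray_step x i e r) (@ray_line x i e _) axis_ge0 zn.
by exists (i + sg e r).
Qed.

(** As [z] is far from [y] and [y'], exchanging them for nearby points of the axis costs only
    [delta] each, and [K] disappears from the bound. *)
Lemma axis_mid z y y' x i j K c' : gp z y y' <= c' ->
    D y (x * fz i)%g <= K -> D y' (x * fz j)%g <= K ->
    K + c' + 2 * delta < D z y -> K + c' + 2 * delta < D z y' ->
  exists k, D z (x * fz k)%g <= c' + s + 2 * c + 4 * delta.
Proof.
move=> zc yi yj zy zy'; have d0 := dist_delta hD.
have h1 := gp_near hD z y (x * fz i)%g; have h2 := gp_near hD z y' (x * fz j)%g.
have h3 : gp z (x * fz i)%g y' <= c' + delta by apply: (gp_lt hD _ zc); lra.
have h4 : gp z (x * fz j)%g (x * fz i)%g <= c' + delta + delta.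
  by rewrite (gpC hD) in h3; apply: (gp_lt hD _ h3); lra.
rewrite (gpC hD) in h4; have [k kP] := axis_close h4; exists k; lra.
Qed.

(** Both points of index [r] are at distance [D 1 (f^r)] from [1], up to [K], in directions that
    agree beyond them. Equal indices, not just equal distances, are what makes powers commute
    later. *)
Lemma fellow_travel u e e' n m K r : D 1%g u <= K ->
    D (fz (sg e n)) (u * fz (sg e' m))%g <= K -> (r <= n)%N -> (r <= m)%N ->
  D (fz (sg e r)) (u * fz (sg e' r))%g <= 4 * c + 3 * K + 4 * delta.
Proof.
move=> uK nmK rn rm.
have line (b : bool) l : (r <= l)%N ->
    D 1%g (fz r%:Z) - c <= gp 1%g (fz (sg b r)) (fz (sg b l)).
  move=> rl; have := ray_line 1%g 0 b rl; have := gp_split hD 1%g (fz (sg b r)) (fz (sg b l)).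
  rewrite !mul1g !add0r dist_sg; have -> : sg b 0 = 0 by case: b; rewrite /sg ?oppr0.
  by rewrite /=; lra.
have len : D 1%g (fz r%:Z) - c <= D 1%g (fz n%:Z).
  have := line e n rn; have := gp_ler hD 1%g (fz (sg e r)) (fz (sg e n)).
  by rewrite dist_sg; lra.
pose t := D 1%g (fz r%:Z) - 2 * c - K.
have c0 := axis_c; have K0 : 0 <= K by apply: le_trans uK; exact: dist_ge0 hD _ _.
have h1 : t <= gp 1%g (fz (sg e r)) (fz (sg e n)) by have := line e n rn; rewrite /t; lra.
have h2 : t <= gp 1%g (fz (sg e n)) (u * fz (sg e' m))%g.
  by have := gp_near hD 1%g (fz (sg e n)) (u * fz (sg e' m))%g; rewrite dist_sg /t; lra.
have h3 : t - delta <= gp 1%g (u * fz (sg e' m))%g (u * fz (sg e' r))%g.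
  have := gp_lip hD (u * 1)%g 1%g (u * fz (sg e' m))%g (u * fz (sg e' r))%g.
  rewrite (gp_inv hD) [gp 1%g (fz _) _](gpC hD) mulg1 (dist_sym hD u).
  by have := line e' m rm; have := dist_delta hD; rewrite /t; lra.
have h4 := dist_hyp hD (dist_hyp hD h1 h2) h3.
have : D 1%g (u * fz (sg e' r))%g <= K + D 1%g (fz r%:Z).
  have := dist_triangle hD 1%g (u * 1)%g (u * fz (sg e' r))%g.
  by rewrite (dist_inv hD) mulg1 dist_sg; lra.
move: h4; rewrite [gp 1%g (fz (sg e r)) (u * _)%g]gpE dist_sg /t; lra.
Qed.

Lemma fz_sgD k e m n : (fz (k + sg e (m + n)) = fz (k + sg e m) * fz (sg e n))%g.
Proof. by rewrite -zpowD; congr zpow; rewrite /sg; case: e; lia. Qed.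

Lemma fz_sg e t q : fz (sg e (t * q)) = (fz (sg e t) ^+ q)%g.
Proof. by rewrite -zpowM; congr zpow; rewrite /sg; case: e; lia. Qed.

(** Invariance puts one of the two far apart points at [1]. The pigeonhole principle relies on [N]
    depending on [E] only. *)
Hypothesis acyl : forall E : R, exists (L : R) (N : nat), forall y, L < D 1%g y ->
  exists l : seq G, (size l <= N)%N /\
    forall g, D 1%g g < E -> D y (g * y)%g < E -> g \in l.

(* The elements [f^-t u f^(+-t)] almost fix two far apart points; by the pigeonhole
   principle two of them coincide. *)
Lemma fellow_travel_commute K : exists N, forall u e e' n m, D 1%g u <= K ->
    D (fz (sg e n)) (u * fz (sg e' m))%g <= K -> (N <= n)%N -> (N <= m)%N ->
  exists t, (0 < t <= N)%N /\ (fz (sg e t) * u = u * fz (sg e' t))%g.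
Proof.
pose C := 4 * c + 3 * K + 4 * delta.
have [L [N NP]] := acyl (2 * C + 1).
pose r0 := (Num.truncn L).+1; exists (N + r0)%N => u e e' n m uK nmK Nn Nm.
have close r : (r <= N + r0)%N -> D (fz (sg e r)) (u * fz (sg e' r))%g <= C.
  by move=> rN; apply: fellow_travel uK nmK _ _; lia.
pose x t := ((fz (sg e t))^-1 * u * fz (sg e' t))%g.
have xE r t : (fz (sg e t) * (x t * fz (sg e' r)) = u * fz (sg e' (t + r)))%g.
  rewrite /x -!mulgA mulVKg -zpowD; congr (_ * zpow _ _)%g.
  by rewrite /sg; case: (e'); lia.
have xC r t : (t + r <= N + r0)%N -> D (fz (sg e r)) (x t * fz (sg e' r))%g <= C.
  move=> /close; rewrite -xE -[fz (sg e (t + r))]mul1g.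
  have := fz_sgD 0 e t r; rewrite !add0r => ->.
  by rewrite mul1g (dist_inv hD).
have Ly : L < D 1%g (fz (sg e' r0)).
  by rewrite dist_sg (lt_le_trans (truncnS_gt L))// dist_fz_ge.
have [l [lN lP]] := NP _ Ly.
have sub : {subset [seq (u^-1 * x t)%g | t <- iota 0 N.+1] <= l}.
  move=> _ /mapP[t + ->]; rewrite mem_iota add0n ltnS => /andP[_ tN].
  have sg0 b : fz (sg b 0) = 1%g by case: b.
  apply: lP.
    have := xC 0%N t; have := xC 0%N 0%N; rewrite !sg0 !mulg1 add0n addn0.
    have -> : x 0%N = u by rewrite /x !sg0 mulg1 invg1 mul1g.
    move=> /(_ isT) h1 /(_ _) h2; have {}h2 : D 1%g (x t) <= C by apply: h2; lia.
    by have := dist_triangle hD u 1%g (x t); rewrite (dist_mulVg hD) (dist_sym hD u 1%g); lra.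
  have h1 := close r0 (leq_addl _ _);
  have h2 : D (fz (sg e r0)) (x t * fz (sg e' r0))%g <= C by apply: xC; lia.
  have := dist_triangle hD (u * fz (sg e' r0))%g (fz (sg e r0)) (x t * fz (sg e' r0))%g.
  have -> : D (fz (sg e' r0)) (u^-1 * x t * fz (sg e' r0))%g =
      D (u * fz (sg e' r0))%g (x t * fz (sg e' r0))%g.
    by rewrite -(dist_inv hD u) !mulgA mulgV mul1g.
  by rewrite (dist_sym hD (u * _)%g (fz _)); lra.
have /(uniqPn 1%g)[i [j [ij]]] : ~~ uniq [seq (u^-1 * x t)%g | t <- iota 0 N.+1].
  by apply/negP => /uniq_leq_size/(_ sub); rewrite size_map size_iota leqNgt ltnS lN.
rewrite size_map size_iota => jN.
rewrite !(nth_map 0%N) ?size_iota ?nth_iota ?add0n; try lia.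
move=> /mulgI xij; exists (j - i)%N; split; first by lia.
have := xE 0%N i; have := xE 0%N j; rewrite -xij !addn0.
have -> : sg e' 0 = 0 by case: (e').
rewrite !mulg1 => ej ei.
have jiE b : fz (sg b j) = (fz (sg b (j - i)) * fz (sg b i))%g.
  by rewrite -zpowD; congr zpow; rewrite /sg; case: b; lia.
by apply: (mulIg (fz (sg e' i))); rewrite -!mulgA -jiE -ej -ei mulgA -jiE.
Qed.

End Axis.

(** * Elements that match a long piece of the axis with itself *)

Section Stabilizer.
Variables (R : realType) (G : groupType) (D : G -> G -> R) (delta : R).
Variables (f : G) (c : R).
Local Open Scope ring_scope.
Hypothesis hD : hyperbolic_distance D delta.
Local Notation gp := (gp D).
Local Notation fz := (zpow f).
Hypothesis axf : is_axis D f c.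
Hypothesis acyl : forall E : R, exists (L : R) (N : nat), forall y, L < D 1%g y ->
  exists l : seq G, (size l <= N)%N /\
    forall g, D 1%g g < E -> D y (g * y)%g < E -> g \in l.

Local Notation s := (D 1%g f).

(** The bound of [axis_mid] for [c' = c]. *)
Definition axis_const := 3 * c + s + 4 * delta.

Lemma fz_comm i j : (fz i * fz j = fz j * fz i)%g.
Proof. by rewrite -!zpowD addrC. Qed.

(** That [N] precedes [K] is the point: away from the ends, the distance between the two axes
    improves from [K] to [axis_const], to which [fellow_travel_commute] is applied. *)
Lemma fellow_axes : exists N, forall K, exists rho : R, forall x i j k l,
    D (x * fz i)%g (fz k) <= K -> D (x * fz j)%g (fz l) <= K ->
    rho < D (fz k) (fz l) ->
  exists e e' t, (0 < t <= N)%N /\ (fz (sg e t) * x = x * fz (sg e' t))%g.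
Proof.
have [N NP] := fellow_travel_commute hD axf acyl axis_const.
exists N => K; pose r0 := (Num.truncn (K + c + 2 * delta)).+1.
have r0P : K + c + 2 * delta < r0%:R := truncnS_gt _.
(* Long enough that the matching piece of the other axis also has at least [N] steps. *)
pose n0 := (N + Num.truncn (s * N%:R + 2 * axis_const)).+1.
have n0P : s * N%:R + 2 * axis_const < n0%:R.
  by rewrite (lt_le_trans (truncnS_gt _))// ler_nat /n0 ltnS leq_addl.
exists (s * (r0 + r0 + n0)%:R) => x i j k l xi xj kl.
have [e lkE] := sgP (l - k); set n := `|l - k|%N in lkE.
have nP : (r0 + r0 + n0 < n)%N.
  rewrite ltnNge; apply/negP => nle; move: kl; rewrite (dist_fz _ hD) lkE (dist_sg _ hD).
  have := dist_fz_le f hD n; have : s * n%:R <= s * (r0 + r0 + n0)%:R.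
    by rewrite ler_wpM2l ?(axis_ge0 _ hD)// ler_nat.
  by lra.
have n0n : (n0 <= n - r0 - r0)%N by move: (r0) (n0) (n) nP => ? ? ? ?; lia.
have mid r : (r0 <= r)%N -> (r + r0 <= n)%N ->
    exists i', D (fz (k + sg e r)) (x * fz i')%g <= axis_const.
  move=> r0r rn; have line := ray_line hD axf 1%g k e (r := r) (n := n).
  rewrite !mul1g in line; have {}line := line (leq_trans (leq_addr _ _) rn).
  have e0 : k + sg e 0 = k by rewrite /sg; case: (e); rewrite ?oppr0 addr0.
  have en : k + sg e n = l by rewrite -lkE addrC subrK.
  rewrite e0 en in line.
  have [||||i' i'P] := axis_mid hD axf (x := x) (i := i) (j := j) (K := K) line.
  - by rewrite (dist_sym hD).
  - by rewrite (dist_sym hD).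
  - rewrite (dist_sym hD) (dist_fz _ hD).
    have -> : k + sg e r - k = sg e r by rewrite addrC addKr.
    rewrite (dist_sg _ hD).
    by apply: lt_le_trans r0P _; apply: le_trans (dist_fz_ge axf r); rewrite ler_nat.
  - rewrite (dist_fz _ hD) -en; have -> : k + sg e n - (k + sg e r) = sg e (n - r)%N.
      by rewrite /sg; case: (e); lia.
    rewrite (dist_sg _ hD); apply: lt_le_trans r0P _; apply: le_trans (dist_fz_ge axf _).
    by rewrite ler_nat; lia.
  by exists i'; apply: le_trans i'P _; rewrite /axis_const; lra.
have [||i1 i1P] := mid r0; try lia.
have [||i2 i2P] := mid (n - r0)%N; try lia.
pose u := ((fz (k + sg e r0))^-1 * x * fz i1)%g.
have uK : D 1%g u <= axis_const by rewrite /u -mulgA (dist_mulVg hD).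
have [e' i12E] := sgP (i2 - i1); set m := `|i2 - i1|%N in i12E.
have umK : D (fz (sg e (n - r0 - r0)%N)) (u * fz (sg e' m))%g <= axis_const.
  rewrite -(dist_inv hD (fz (k + sg e r0))) /u !mulgA mulgV mul1g -mulgA -!zpowD.
  rewrite -i12E [(i1 + _)%R]addrC subrK.
  have -> // : k + sg e r0 + sg e (n - r0 - r0)%N = k + sg e (n - r0)%N.
  by move: (r0) (n0) (n) (e) nP; clear => a a0 b [] ab; rewrite /sg; lia.
have Nm : (N <= m)%N.
  rewrite leqNgt; apply/negP => mN.
  have h1 : (n - r0 - r0)%N%:R <= D 1%g (fz (sg e (n - r0 - r0)%N)).
    by rewrite (dist_sg _ hD) (dist_fz_ge axf).
  have h2 : D u (u * fz (sg e' m))%g <= s * N%:R.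
    rewrite -{1}(mulg1 u) (dist_inv hD) (dist_sg _ hD) (le_trans (dist_fz_le f hD m))//.
    by rewrite ler_wpM2l ?(axis_ge0 _ hD)// ler_nat ltnW.
  have h3 : n0%:R <= (n - r0 - r0)%N%:R :> R by rewrite ler_nat.
  have := dist_triangle hD 1%g u (fz (sg e (n - r0 - r0)%N)).
  have := dist_triangle hD u (u * fz (sg e' m))%g (fz (sg e (n - r0 - r0)%N)).
  by rewrite (dist_sym hD (u * _)%g (fz _)); lra.
have [|t [tN tu]] := NP u e e' _ m uK umK _ Nm.
  by apply: leq_trans n0n; rewrite /n0 leqW// leq_addr.
exists e, e', t; split=> //.
apply: (mulgI (fz (k + sg e r0))^-1%g); apply: (mulIg (fz i1)).
move: tu; rewrite /u -zpowN !mulgA fz_comm -!mulgA => ->.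
by rewrite fz_comm.
Qed.

(** The exponent [t] varies with [x] but is at most [N], so it divides the factorial [M]; the sign
    tells whether the two directions agree. *)
Lemma axis_stabilizer : exists M, (0 < M)%N /\ forall K, exists rho : R, forall x i j k l,
    D (x * fz i)%g (fz k) <= K -> D (x * fz j)%g (fz l) <= K ->
    rho < D (fz k) (fz l) ->
  (x * fz M * x^-1 = fz M)%g \/ (x * fz M * x^-1 = fz (- M%:Z))%g.
Proof.
have [N NP] := fellow_axes; exists N`!; split; first exact: fact_gt0.
move=> K; have [rho rhoP] := NP K; exists rho => x i j k l xi xj kl.
have [e [e' [t [tN tx]]]] := rhoP x i j k l xi xj kl.
have [q tq] : exists q, N`! = (t * q)%N.
  by have /dvdnP[q ->] := dvdn_fact tN; exists q; rewrite mulnC.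
have {}tx : (x * fz (sg e' N`!) * x^-1 = fz (sg e N`!))%g.
  rewrite tq !fz_sg; apply/esym/(mulIg x); rewrite mulgVK.
  elim: q {tq} => [|q IH]; first by rewrite !expg0 mul1g mulg1.
  by rewrite [in LHS]expgSr [in RHS]expgS -mulgA tx mulgA IH -mulgA -expgSr expgS.
have conjN n : (x * fz (- n) * x^-1 = (x * fz n * x^-1)^-1)%g.
  by rewrite zpowN !invgM invgK mulgA.
case: e e' tx => -[]; rewrite /sg ?conjN => tx; [left|right|right|left] => //.
  by apply: invg_inj; rewrite tx zpowN.
by apply: invg_inj; rewrite tx zpowN invgK.
Qed.

End Stabilizer.

(** * Projections to the cosets of the stabilizer of an axis *)

Section Cosets.
Variables (R : realType) (G : groupType) (D : G -> G -> R) (delta : R).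
Variables (f : G) (c : R) (M : nat).
Local Open Scope ring_scope.
Hypothesis hD : hyperbolic_distance D delta.
Local Notation gp := (gp D).
Local Notation fz := (zpow f).
Local Notation s := (D 1%g f).
Local Notation C0 := (axis_const D delta f c).
Hypothesis axf : is_axis D f c.
Hypothesis M_gt0 : (0 < M)%N.

(** An algebraic form of the stabilizer of the axis, which makes it visibly a subgroup. The geometry
    enters twice: elements matching long pieces of the axis belong to it, and by [stab_close] its
    elements stay uniformly close to the axis. *)
Definition stab : set G := [set x | (x * fz M * x^-1 = fz M)%g \/
  (x * fz M * x^-1 = fz (- M%:Z))%g].

Hypothesis fellow_stab : forall K, exists rho : R, forall x i j k l,
    D (x * fz i)%g (fz k) <= K -> D (x * fz j)%g (fz l) <= K ->
  rho < D (fz k) (fz l) -> stab x.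

Lemma stabE x : stab x -> exists e, forall n, (x * fz (M%:Z * n) * x^-1 = fz (sg e M * n))%g.
Proof.
have pow (e : bool) : (x * fz M * x^-1 = fz (sg e M))%g ->
    forall n, (x * fz (M%:Z * n) * x^-1 = fz (sg e M * n))%g.
  move=> xe n; have powN (q : nat) : (x * fz (M%:Z * q%:Z) * x^-1 = fz (sg e M * q%:Z))%g.
    rewrite !zpowM -xe; elim: q => [|q IH]; first by rewrite !expg0 mulg1 mulgV.
    by rewrite !expgS -IH !mulgA mulgVK.
  case: n => n; first exact: powN.
  by rewrite NegzE !mulrN !zpowN -powN !invgM invgK mulgA.
by case=> xM; [exists false|exists true]; exact: pow.
Qed.

Lemma stab_zpow n : stab (fz n).
Proof. by left; rewrite -zpowN -!zpowD addrAC subrr add0r. Qed.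

Lemma stab1 : stab 1%g. Proof. exact: (stab_zpow 0). Qed.

Lemma stabM x y : stab x -> stab y -> stab (x * y)%g.
Proof.
have conjN z n : (z * fz (- n) * z^-1 = (z * fz n * z^-1)^-1)%g.
  by rewrite zpowN !invgM invgK mulgA.
have xyE : (x * y * fz M * (x * y)^-1 = x * (y * fz M * y^-1) * x^-1)%g.
  by rewrite invgM !mulgA.
rewrite /stab /= xyE => xS [-> //|->]; rewrite conjN.
by case: xS => ->; [right; rewrite zpowN|left; rewrite zpowN invgK].
Qed.

Lemma stabV x : stab x -> stab x^-1%g.
Proof.
rewrite /stab /= invgK => -[xM|xM]; [left|right].
  by rewrite -{1}xM !mulgA mulVg mul1g mulgVK.
apply: (mulgI x); apply: (mulIg x^-1%g); rewrite !mulgA mulgV mul1g mulgK.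
by apply: invg_inj; rewrite zpowN !invgM !invgK mulgA xM zpowN.
Qed.

(** Since [h] conjugates powers of [f^M] to powers, the translate of the axis by [h] has points in
    both directions that are far out but within [D h 1] of the axis. As [h] lies between them,
    [axis_mid] gives a bound free of [h]. *)
Lemma stab_close h : stab h -> exists j, D h (fz j) <= C0.
Proof.
move=> hS; have [e he] := stabE hS; pose K := D h 1%g.
have d0 := dist_delta hD; have c0 := axis_c hD axf.
pose q := (Num.truncn (K + c + 2 * delta)).+1.
have qP : K + c + 2 * delta < q%:R := truncnS_gt _.
have hn n : D (h * fz (M%:Z * n))%g (1 * fz (sg e M * n))%g <= K.
  by rewrite mul1g -{1}(mulgVK h (h * fz (M%:Z * n))%g) he -{2}(mulg1 (fz (_ * n)))
    (dist_inv hD).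
have far n : q%:R <= (`|n|%N)%:R :> R -> K + c + 2 * delta < D h (h * fz (M%:Z * n))%g.
  move=> qn; rewrite -{1}(mulg1 h) (dist_inv hD); apply: lt_le_trans qP _.
  apply: le_trans qn (le_trans _ (axis_proper axf _)).
  have -> : (`|n|%N)%:R = ((`|n|%N)%:Z)%:~R :> R by [].
  by rewrite ler_int abszE normrM ler_peMl//; lia.
have line : gp h (h * fz (M%:Z * (- q%:Z)))%g (h * fz (M%:Z * q%:Z))%g <= c.
  rewrite -{1}(mulg1 h) (gp_inv hD); apply: (axis_line axf (j := 0)); lia.
have [||j jP] := axis_mid hD axf line (hn _) (hn _).
- by apply: far; rewrite abszN.
- exact: far.
by exists j; rewrite mul1g in jP; apply: le_trans jP _; rewrite /axis_const; lra.
Qed.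

Definition coset (g : G) : set G := [set y | stab (g^-1 * y)%g].

Lemma coset_id g : coset g g. Proof. by rewrite /coset /= mulVg; exact: stab1. Qed.

Lemma coset_sym g y : coset g y -> coset y g.
Proof. by move=> /stabV; rewrite invgM invgK. Qed.

Lemma coset_trans g y z : coset g y -> coset y z -> coset g z.
Proof. by move=> gy yz; have := stabM gy yz; rewrite mulgA mulgK. Qed.

Lemma coset_eq g y : coset g y -> coset g = coset y.
Proof.
move=> gy; apply/seteqP; split=> z; apply: coset_trans => //; exact: coset_sym.
Qed.

Lemma coset_mul k g y : coset (k * g)%g (k * y)%g <-> coset g y.
Proof. by rewrite /coset /= invgM -mulgA mulKg. Qed.

Lemma coset_mulr g h : stab h -> coset g (g * h)%g.
Proof. by rewrite /coset /= mulKg. Qed.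

(* Nearest points need not exist, hence the slack [1]. *)
Definition proj (Y : set G) x y := Y y /\ forall y', Y y' -> D x y <= D x y' + 1.

Lemma proj_exists (Y : set G) x : Y !=set0 -> exists y, proj Y x y.
Proof.
move=> [y0 Yy0].
have /ex_minnP[n /asboolP[y [Yy yn]] nmin] : exists n, `[< exists y, Y y /\ D x y < n%:R >].
  by exists (Num.truncn (D x y0)).+1; apply/asboolP; exists y0; split=> //; exact: truncnS_gt.
exists y; split=> // y' Yy'; rewrite leNgt; apply/negP => y'y.
case: n yn nmin => [|n] yn nmin; first by have := dist_ge0 hD x y; lra.
have := nmin n; rewrite ltnn; suff -> : `[< exists y, Y y /\ D x y < n%:R >] by move/(_ isT).
by apply/asboolP; exists y'; split=> //; rewrite -natr1 in yn; lra.
Qed.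

Definition proj_const := s + 2 * c + 2 * delta + 1 + C0.

Lemma s_ge0 : 0 <= s. Proof. exact: axis_ge0 f hD. Qed.

(** Otherwise the point at distance about [gp y x y'] from [y] on the way to [y'] would be
    noticeably nearer to [x]. *)
Lemma proj_gp g x y y' : proj (coset g) x y -> coset g y' -> gp y x y' <= proj_const.
Proof.
move=> [gy xy] gy'; set h := (y^-1 * y')%g.
have hS : stab h by have := coset_trans (coset_sym gy) gy'.
have [j hj] := stab_close hS; have [e je] := sgP j; set n := `|j|%N in je.
have line r : (r <= n)%N -> gp (fz (sg e r)) (fz (sg e 0)) (fz (sg e n)) <= c.
  by move=> rn; have := ray_line hD axf 1%g 0 e rn; rewrite !mul1g !add0r.
have step r : (r < n)%N -> D (fz (sg e r)) (fz (sg e r.+1)) <= s.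
  by move=> _; have := ray_step f hD 1%g 0 e r; rewrite !mul1g !add0r.
have sg0 : fz (sg e 0) = 1%g by case: (e).
set x1 := (y^-1 * x)%g; pose t := gp 1%g x1 (fz j).
have [|r rn] := quasiline_ivt hD step (t := t) s_ge0.
  by rewrite sg0 -je (gp_ge0 hD) (gp_ler hD).
rewrite sg0 => /andP[tr rt].
have h1 : t - c <= gp 1%g (fz j) (fz (sg e r)).
  have := gp_split hD 1%g (fz (sg e r)) (fz j); have := line r rn; rewrite -je sg0.
  by rewrite [gp 1%g (fz (sg e r)) _](gpC hD); lra.
have tc : t - c <= t by have := axis_c hD axf; lra.
have := dist_hyp hD (tc : t - c <= gp 1%g x1 (fz j)) h1.
rewrite gpE => h2.
have : D x y <= D x (y * fz (sg e r))%g + 1.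
  by apply: xy; apply: coset_trans gy (coset_mulr _ (stab_zpow _)).
have -> : D x y = D 1%g x1 by rewrite /x1 (dist_mulVg hD) (dist_sym hD).
have -> : D x (y * fz (sg e r))%g = D x1 (fz (sg e r)).
  by rewrite -[RHS](dist_inv hD y) /x1 mulVKg.
have := gp_lipr hD 1%g x1 h (fz j).
have -> : gp 1%g x1 h = gp y x y'.
  by rewrite -(gp_inv hD y) mulg1 /x1 /h !mulVKg.
by rewrite -/t /proj_const; lra.
Qed.

Lemma proj_far g x y x' y' : proj (coset g) x x' -> proj (coset g) y y' ->
  2 * proj_const + delta < D x' y' -> gp x' x y <= proj_const + delta.
Proof.
move=> xx' yy' far; rewrite (gpC hD).
have h1 := proj_gp xx' (proj1 yy'); have h2 := proj_gp yy' (proj1 xx').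
rewrite (gpC hD) in h1; apply: (gp_lt hD _ h1).
have := gp_split hD x' y' y; rewrite [gp y' x' y](gpC hD); lra.
Qed.

(** If the projections were far apart, both would be close to the piece of the coset of [x] from
    [x1] to [x2]; the two axes would run together for longer than [rho], and the cosets would
    coincide. *)
Lemma proj_bounded : exists K, forall g x x1 x2 y1 y2, ~ coset g x ->
  coset x x1 -> coset x x2 -> proj (coset g) x1 y1 -> proj (coset g) x2 y2 ->
  D y1 y2 <= K.
Proof.
pose c1 := proj_const + delta + C0.
pose K0 := c1 + s + 2 * c + 2 * delta + C0.
have [rho rhoP] := fellow_stab K0.
exists (Num.max (2 * proj_const + delta) (rho + 2 * C0)) => g x x1 x2 y1 y2 gx xx1 xx2 p1 p2.
rewrite leNgt; apply/negP; rewrite gt_max => /andP[far1 far2].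
have [j hj] := stab_close (coset_trans (coset_sym xx1) xx2).
have {}hj : D x2 (x1 * fz j)%g <= C0 by rewrite -(dist_inv hD x1^-1%g) mulKg.
have x1E : x1 = (x1 * fz 0)%g by rewrite mulg1.
have close y : gp y x1 x2 <= proj_const + delta -> coset g y ->
    exists i k, D (g^-1 * x1 * fz i)%g (fz k) <= K0 /\ D (g^-1 * y)%g (fz k) <= C0.
  move=> yx gy; have [k kP] := stab_close gy.
  have : gp y (x1 * fz 0)%g (x1 * fz j)%g <= c1.
    rewrite -x1E; have := gp_lipr hD y x1 (x1 * fz j)%g x2.
    by rewrite (dist_sym hD _ x2) /c1; lra.
  move=> /(axis_close hD axf)[i iP]; exists i, k; split=> //.
  have := dist_triangle hD (g^-1 * x1 * fz i)%g (g^-1 * y)%g (fz k).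
  by rewrite -mulgA (dist_inv hD) (dist_sym hD _ y) /K0; lra.
have [i1 [k1 [ik1 yk1]]] := close y1 (proj_far p1 p2 far1) (proj1 p1).
have [|i2 [k2 [ik2 yk2]]] := close y2 _ (proj1 p2).
  by rewrite (gpC hD); apply: proj_far p2 p1 _; rewrite (dist_sym hD).
apply: gx; apply: coset_trans (coset_sym xx1).
apply: (rhoP (g^-1 * x1)%g i1 i2 k1 k2 ik1 ik2).
have := dist_triangle hD (g^-1 * y1)%g (fz k1) (g^-1 * y2)%g.
have := dist_triangle hD (fz k1) (fz k2) (g^-1 * y2)%g.
by rewrite (dist_inv hD) (dist_sym hD (fz k2)); lra.
Qed.

End Cosets.

(** * The Behrstock inequality and finiteness for cosets *)

Section CosetProjections.
Variables (R : realType) (G : groupType) (D : G -> G -> R) (delta : R).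
Variables (f : G) (c : R) (M : nat).
Local Open Scope ring_scope.
Hypothesis hD : hyperbolic_distance D delta.
Local Notation gp := (gp D).
Local Notation fz := (zpow f).
Local Notation C' := (proj_const D delta f c).
Local Notation C0 := (axis_const D delta f c).
Local Notation coset := (coset f M).
Local Notation proj := (proj D).
Hypothesis axf : is_axis D f c.
Hypothesis M_gt0 : (0 < M)%N.

(** Were both distances large, [p] would lie between [x1] and [a], and [a] between [x1] and [p], up
    to [C' + delta]. Adding, [a] and [p] are close, hence so are [p] and the projection [q] of [a]:
    a contradiction. The term [2 * K] pays for changes of base points. *)
Lemma proj_behrstock K (x y z x1 x2 y2 z1 a b a' b' : G) :
    (forall g x x1 x2 y1 y2, ~ coset g x -> coset x x1 -> coset x x2 ->
      proj (coset g) x1 y1 -> proj (coset g) x2 y2 -> D y1 y2 <= K) ->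
    ~ coset y x -> ~ coset z x -> ~ coset z y -> ~ coset y z ->
    coset x x1 -> coset z z1 -> coset x x2 -> coset y y2 ->
    proj (coset y) x1 a -> proj (coset y) z1 b ->
    proj (coset z) x2 a' -> proj (coset z) y2 b' ->
  2 * K + 4 * C' + 4 * delta + 1 < D a b -> D a' b' <= 2 * K + 4 * C' + 4 * delta + 1.
Proof.
move=> KP yx zx zy yz xx1 zz1 xx2 yy2 ya yb za' zb' ab.
rewrite leNgt; apply/negP => ab'.
have [p pP] : exists p, proj (coset z) x1 p.
  by apply: (proj_exists hD); exists z; exact: coset_id.
have [q qP] : exists q, proj (coset z) a q.
  by apply: (proj_exists hD); exists z; exact: coset_id.
have [r rP] : exists r, proj (coset y) p r.
  by apply: (proj_exists hD); exists y; exact: coset_id.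
have K0 : 0 <= K by have := KP _ _ _ _ _ _ yx xx1 xx1 ya ya; rewrite (dist_id hD).
have C'0 : 0 <= C'.
  by apply: le_trans (proj_gp hD axf M_gt0 ya (proj1 ya)); exact: gp_ge0 hD _ _ _.
have d0 := dist_delta hD.
have h1 := KP _ _ _ _ _ _ zx xx1 xx2 pP za'.
have h2 := KP _ _ _ _ _ _ zy (proj1 ya) yy2 qP zb'.
have h3 := KP _ _ _ _ _ _ yz (proj1 pP) zz1 rP yb.
have pq : 2 * K + 4 * C' + 4 * delta + 1 - 2 * K < D p q.
  have := dist_triangle hD a' p b'; have := dist_triangle hD p q b'.
  by rewrite (dist_sym hD a' p); lra.
have ar : 2 * K + 4 * C' + 4 * delta + 1 - K < D a r.
  by have := dist_triangle hD a r b; lra.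
have g1 : gp p x1 a <= C' + delta by apply: (proj_far hD axf M_gt0 pP qP); lra.
have g2 : gp a x1 p <= C' + delta by apply: (proj_far hD axf M_gt0 ya rP); lra.
have ap : D a p <= 2 * C' + 2 * delta.
  by have := gp_split hD a p x1; rewrite (gpC hD a p) (gpC hD p a); lra.
have := proj2 qP p (proj1 pP); have := dist_triangle hD p a q.
by rewrite (dist_sym hD p a); lra.
Qed.

Hypothesis acyl : forall E : R, exists (L : R) (N : nat), forall y, L < D 1%g y ->
  exists l : seq G, (size l <= N)%N /\
    forall g, D 1%g g < E -> D y (g * y)%g < E -> g \in l.

(** Near a geodesic from [x] to [z], a point is determined up to bounded error by its distance from
    [x]; the integer part suffices and leaves finitely many positions. *)
Lemma gp_sync x z u v C : gp u x z <= C -> gp v x z <= C ->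
  Num.truncn (D x u) = Num.truncn (D x v) -> D u v <= 2 * C + 2 * delta + 1.
Proof.
move=> uC vC uv.
have uv1 : `|D x u - D x v| <= 1.
  have := Num.Theory.truncn_itv (dist_ge0 hD x u).
  have := Num.Theory.truncn_itv (dist_ge0 hD x v).
  rewrite uv -natr1 => /andP[? ?] /andP[? ?].
  by rewrite ler_norml; lra.
rewrite ler_norml in uv1; have /andP[? ?] := uv1.
pose t := Num.min (D x u) (D x v) - C.
have tu : t <= gp x u z.
  have := gp_split hD x u z; have : Num.min (D x u) (D x v) <= D x u by rewrite ge_min lexx.
  by rewrite /t; lra.
have tv : t <= gp x z v.
  have := gp_split hD x v z.
  have : Num.min (D x u) (D x v) <= D x v by rewrite ge_min lexx orbT.
  by rewrite /t (gpC hD x z v); lra.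
have := dist_hyp hD tu tv; rewrite gpE /t.
by have [?|?] := leP (D x u) (D x v); lra.
Qed.

(** Such a coset contains some [g0] and [g0 * f^n], far apart and both near a geodesic from [x] to
    [z]. There are finitely many values of [n] and of the rounded distances to [x]; when these agree
    for [u] and [v], the element [u^-1 * v] moves [1] and [f^n] little, so acylindricity leaves
    finitely many. *)
Lemma proj_finite : exists K, forall x z, finite_set [set Y | exists g a b,
  [/\ Y = coset g, proj Y x a, proj Y z b & K < D a b]].
Proof.
pose C1 := C' + delta + C0.
have [L [N NP]] := acyl (2 * C1 + 2 * delta + 2).
exists (Num.max (2 * C' + delta) (L + 2 * C0)) => x z.
pose B := D x z + 2 * C1; pose m := (Num.truncn (2 * B)).+1.
pose good n g0 := gp g0 x z <= C1 /\ gp (g0 * fz n)%g x z <= C1.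
pose S (t : bool * 'I_m * 'I_m * 'I_m) := [set g0 | [/\
  L < D 1%g (fz (sg t.1.1.1 t.1.1.2)), good (sg t.1.1.1 t.1.1.2) g0,
  Num.truncn (D x g0) = t.1.2 & Num.truncn (D x (g0 * fz (sg t.1.1.1 t.1.1.2))%g) = t.2]].
have finS t : finite_set (S t).
  case: (pselect (S t !=set0)) => [[u [Ln [u1 u2] u3 u4]]|/nonemptyPn->//].
  have [l [_ lP]] := NP _ Ln.
  apply: sub_finite_set (finite_image (fun v => u * v)%g (finite_seq l)) => v [_ [v1 v2] v3 v4].
  exists (u^-1 * v)%g; last by rewrite /= mulVKg.
  apply: lP.
    by rewrite (dist_mulVg hD); have := gp_sync u1 v1 (etrans u3 (esym v3)); lra.
  have := gp_sync u2 v2 (etrans u4 (esym v4)).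
  by rewrite -(dist_inv hD u (fz _)) mulgA mulVKg; lra.
have finU := bigcup_finite (finite_finset (X := setT)) (fun t _ => finS t).
apply: sub_finite_set (finite_image coset finU).
move=> Y [g [a [b [-> pa pb]]]]; rewrite gt_max => /andP[far1 far2].
have ga := proj_far hD axf M_gt0 pa pb far1.
have gb : gp b x z <= C' + delta.
  by rewrite (gpC hD); apply: (proj_far hD axf M_gt0 pb pa); rewrite (dist_sym hD).
have [k ak] := stab_close hD axf M_gt0 (proj1 pa).
have [l bl] := stab_close hD axf M_gt0 (proj1 pb).
have {}ak : D a (g * fz k)%g <= C0 by rewrite -(dist_inv hD g^-1%g) mulKg.
have {}bl : D b (g * fz l)%g <= C0 by rewrite -(dist_inv hD g^-1%g) mulKg.
pose u := (g * fz k)%g; have ul : (u * fz (l - k) = g * fz l)%g.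
  by rewrite /u -mulgA -zpowD addrC subrK.
have gu : good (l - k) u.
  split; rewrite ?ul /C1.
    by have := gp_lip hD u a x z; rewrite (dist_sym hD u); lra.
  by have := gp_lip hD (g * fz l)%g b x z; rewrite (dist_sym hD _ b); lra.
have Lkl : L < D 1%g (fz (l - k)).
  rewrite -(dist_inv hD u) mulg1 ul.
  have := dist_triangle hD a u b; have := dist_triangle hD u (g * fz l)%g b.
  by rewrite (dist_sym hD (g * fz l)%g b); lra.
have BP v : gp v x z <= C1 -> D x v <= B.
  rewrite gpE (dist_sym hD v x) /B => ?.
  by have := dist_ge0 hD v z; have := dist_triangle hD x v z; lra.
have [gu1 gu2] := gu; have B1 := BP _ gu1; have B2 := BP _ gu2.
have m_lt r : 0 <= r -> r <= 2 * B -> (Num.truncn r < m)%N.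
  by move=> r0 rB; rewrite ltnS le_truncn.
have klB : D 1%g (fz (l - k)) <= 2 * B.
  rewrite -(dist_inv hD u) mulg1; have := dist_triangle hD u x (u * fz (l - k))%g.
  by rewrite (dist_sym hD u x); lra.
have [e klE] := sgP (l - k).
have nm : (`|(l - k)%R|%N < m)%N.
  have := m_lt _ (dist_ge0 hD _ _) klB; apply: leq_ltn_trans.
  have := axis_proper axf (l - k).
  have -> : `|l - k|%:~R = (`|(l - k)%R|%N)%:R :> R by rewrite -abszE.
  by move=> ?; rewrite -[leqLHS](@natrK R) le_truncn.
have B0 : 0 <= B by have := dist_ge0 hD x u; lra.
have um : (Num.truncn (D x u) < m)%N by apply: m_lt; [exact: dist_ge0 hD _ _|lra].
have vm : (Num.truncn (D x (u * fz (l - k))%g) < m)%N.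
  by apply: m_lt; [exact: dist_ge0 hD _ _|lra].
exists u; last by apply/esym/coset_eq/coset_mulr/stab_zpow.
exists (e, Ordinal nm, Ordinal um, Ordinal vm) => //=; split=> //=; rewrite -klE//.
Qed.

End CosetProjections.

(** * The projection system of the cosets *)

Section CosetSystem.
Variables (R : realType) (G : groupType) (D : G -> G -> R) (delta : R).
Variables (f b : G) (c : R) (M : nat).
Local Open Scope ring_scope.
Hypothesis hD : hyperbolic_distance D delta.
Local Notation fz := (zpow f).
Local Notation coset := (coset f M).
Local Notation proj := (proj D).
Hypothesis axf : is_axis D f c.
Hypothesis M_gt0 : (0 < M)%N.
Hypothesis fellow_stab : forall K, exists rho : R, forall x i j k l,
    D (x * fz i)%g (fz k) <= K -> D (x * fz j)%g (fz l) <= K ->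
  rho < D (fz k) (fz l) -> stab f M x.
Hypothesis acyl : forall E : R, exists (L : R) (N : nat), forall y, L < D 1%g y ->
  exists l : seq G, (size l <= N)%N /\
    forall g, D 1%g g < E -> D y (g * y)%g < E -> g \in l.
Hypothesis b_nstab : ~ stab f M b.

Definition diam_bound (Y X Z : set G) (n : nat) := forall x z p q,
  X x -> Z z -> proj Y x p -> proj Y z q -> D p q <= n%:R.

(* [0] when there is no bound, which happens only if [X] or [Z] equals [Y]. *)
Definition proj_diam (Y X Z : set G) : nat :=
  xget 0%N [set n | diam_bound Y X Z n /\ forall m, diam_bound Y X Z m -> (n <= m)%N].

Lemma proj_diamP Y X Z : (exists n, diam_bound Y X Z n) ->
  forall n, (proj_diam Y X Z <= n)%N <-> diam_bound Y X Z n.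
Proof.
move=> bnd n; have [m1 m2] : diam_bound Y X Z (proj_diam Y X Z) /\
    forall m, diam_bound Y X Z m -> (proj_diam Y X Z <= m)%N.
  have : exists n, `[< diam_bound Y X Z n >] by case: bnd => k kP; exists k; apply/asboolP.
  move=> /ex_minnP[m /asboolP mP mmin].
  rewrite /proj_diam; case: xgetP => [k _ [kP kmin]|none]; first by [].
  by have := none m; case; split=> // k /asboolP/mmin.
split=> [dn|/m2//] x z p q Xx Zz xp zq.
by apply: le_trans (m1 x z p q Xx Zz xp zq) _; rewrite ler_nat.
Qed.

Lemma proj_mul g (Y : set G) x y :
  proj [set (g * u)%g | u in Y] (g * x)%g (g * y)%g <-> proj Y x y.
Proof.
split=> -[].
  move=> [u Yu /mulgI <-] min; split=> // y' Yy'.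
  by have := min (g * y')%g; rewrite !(dist_inv hD); apply; exists y'.
move=> Yy min; split; first by exists y.
by move=> _ [u Yu <-]; rewrite !(dist_inv hD); exact: min.
Qed.

Lemma proj_diam_mul g Y X Z : proj_diam [set (g * u)%g | u in Y]
  [set (g * u)%g | u in X] [set (g * u)%g | u in Z] = proj_diam Y X Z.
Proof.
rewrite /proj_diam; suff -> : diam_bound [set (g * u)%g | u in Y]
    [set (g * u)%g | u in X] [set (g * u)%g | u in Z] = diam_bound Y X Z by [].
apply/funext => n; apply/propext; split=> bnd x z p q.
  move=> Xx Zz xp zq; rewrite -(dist_inv hD g).
  by apply: (bnd (g * x)%g (g * z)%g); [exists x|exists z|apply/proj_mul|apply/proj_mul].
move=> [x' Xx <-] [z' Zz <-] xp zq.
have := xp.1 => -[p' _ pE]; have := zq.1 => -[q' _ qE].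
rewrite -pE -qE in xp zq *; rewrite (dist_inv hD).
by apply: (bnd x' z') => //; apply/(proj_mul g).
Qed.

Definition cosets := [set Y | exists g, Y = coset g].

Lemma coset_image g h : [set (g * u)%g | u in coset h] = coset (g * h)%g.
Proof.
apply/seteqP; split=> [_ [u hu <-]|u ghu]; first exact/coset_mul.
by exists (g^-1 * u)%g; rewrite ?mulVKg//; apply/(coset_mul f M g); rewrite mulVKg.
Qed.

Definition coset_act (g : G) (Y : cosets) : cosets.
Proof.
exists [set (g * u)%g | u in val Y]; apply/mem_set.
by have [h ->] := set_mem (valP Y); exists (g * h)%g; exact: coset_image.
Defined.

Definition mk_coset (g : G) : cosets := exist _ (coset g) (mem_set (ex_intro _ g erefl)).

Lemma cosetsP (Y : cosets) : exists g, Y = mk_coset g.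
Proof. by have [g Yg] := set_mem (valP Y); exists g; apply/val_inj. Qed.

Lemma mk_coset_eq g h : mk_coset g = mk_coset h <-> coset g h.
Proof.
split=> [[gh]|gh]; first by rewrite gh; exact: coset_id.
by apply/val_inj; exact: coset_eq.
Qed.

Lemma coset_actE g h : coset_act g (mk_coset h) = mk_coset (g * h)%g.
Proof. by apply/val_inj; exact: coset_image. Qed.

Definition coset_diam (Y X Z : cosets) := proj_diam (val Y) (val X) (val Z).

Lemma neq_coset g h : mk_coset g != mk_coset h -> ~ coset g h.
Proof. by move=> /eqP gh /mk_coset_eq. Qed.

Lemma coset_loxodromic : exists theta,
  loxodromic_system coset_act coset_diam theta (mk_coset 1%g) f b.
Proof.
have [K KP] := proj_bounded hD axf M_gt0 fellow_stab.
have [K' K'P] := proj_finite hD axf M_gt0 acyl.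
pose K2 := 2 * K + 4 * proj_const D delta f c + 4 * delta + 1.
(* [K] serves [prxx], [K2] serves [prB], and [K' + 2 * K] serves [pr_finite], where both ends are
   moved to the chosen representatives. *)
pose theta := (Num.truncn (Num.max K (Num.max K2 (K' + 2 * K)))).+1.
have thetaP : Num.max K (Num.max K2 (K' + 2 * K)) < theta%:R := truncnS_gt _.
rewrite !gt_max in thetaP; have /and3P[tK tK2 tK'] := thetaP.
have pex g x : exists p, proj (coset g) x p.
  by apply: (proj_exists hD); exists g; exact: coset_id.
have bnd y x z : ~ coset y x -> ~ coset y z ->
    exists n, diam_bound (coset y) (coset x) (coset z) n.
  move=> yx yz; have [p pP] := pex y x; have [q qP] := pex y z.
  exists (Num.truncn (2 * K + D p q)).+1 => x1 z1 p1 q1 xx1 zz1 pp1 qq1.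
  apply: ltW (le_lt_trans _ (truncnS_gt _)).
  have := KP _ _ _ _ _ _ yx xx1 (coset_id _ _ x) pp1 pP.
  have := KP _ _ _ _ _ _ yz (coset_id _ _ z) zz1 qP qq1.
  by have := dist_triangle hD p1 p q1; have := dist_triangle hD p q q1; lra.
have dP y x z : ~ coset y x -> ~ coset y z -> forall n,
    (coset_diam (mk_coset y) (mk_coset x) (mk_coset z) <= n)%N <->
    diam_bound (coset y) (coset x) (coset z) n.
  by move=> yx yz; apply: proj_diamP; exact: bnd.
have far y x z n : ~ coset y x -> ~ coset y z ->
    (n < coset_diam (mk_coset y) (mk_coset x) (mk_coset z))%N ->
    exists x1 z1 p q, [/\ coset x x1, coset z z1, proj (coset y) x1 p,
      proj (coset y) z1 q & n%:R < D p q].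
  move=> yx yz; rewrite ltnNge => /negP nd.
  have {}nd : ~ diam_bound (coset y) (coset x) (coset z) n by move=> /(dP _ _ _ yx yz).
  apply: contrapT => none; apply: nd => x1 z1 p q xx1 zz1 pP qP.
  by rewrite leNgt; apply/negP => pq; apply: none; exists x1, z1, p, q.
exists theta; split.
- split.
    split.
    + move=> Y X Z; rewrite /coset_diam /proj_diam; congr (xget _ _).
      have bC (X1 Z1 : set G) n : diam_bound (val Y) X1 Z1 n -> diam_bound (val Y) Z1 X1 n.
        by move=> nP x z p q Xx Zz xp zq; rewrite (dist_sym hD); exact: nP zq xp.
      by apply/seteqP; split=> n [/= n1 n2]; split=> [|m /bC/n2//]; exact: bC.
    + move=> Y X W Z; have [y ->] := cosetsP Y; have [x ->] := cosetsP X.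
      have [w ->] := cosetsP W; have [z ->] := cosetsP Z.
      rewrite ![_ == mk_coset y]eq_sym => /neq_coset yx /neq_coset yw /neq_coset yz.
      apply/(dP _ _ _ yx yz) => x1 z1 p q xx1 zz1 xp zq.
      have [r rP] := pex y w.
      have /(dP _ _ _ yx yw)/(_ x1 w p r) :=
        leqnn (coset_diam (mk_coset y) (mk_coset x) (mk_coset w)).
      have /(dP _ _ _ yw yz)/(_ w z1 r q) :=
        leqnn (coset_diam (mk_coset y) (mk_coset w) (mk_coset z)).
      move=> /(_ (coset_id _ _ w) zz1 rP zq) h1 /(_ xx1 (coset_id _ _ w) xp rP) h2.
      by rewrite natrD; have := dist_triangle hD p r q; lra.
    + move=> Y X; have [y ->] := cosetsP Y; have [x ->] := cosetsP X.
      rewrite eq_sym => /neq_coset yx; apply/(dP _ _ _ yx yx) => x1 z1 p q xx1 xz1 xp zq.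
      by have := KP _ _ _ _ _ _ yx xx1 xz1 xp zq; lra.
    + move=> X Y Z; have [y ->] := cosetsP Y; have [x ->] := cosetsP X.
      have [z ->] := cosetsP Z.
      rewrite [_ == mk_coset y]eq_sym [_ == mk_coset z]eq_sym.
      move=> /neq_coset yx /neq_coset zx yz.
      have zy : ~ coset z y by apply/neq_coset; rewrite eq_sym.
      move/neq_coset: yz => yz.
      move=> /(far _ _ _ _ yx yz)[x1 [z1 [p [q [xx1 zz1 xp zq pq]]]]].
      apply/(dP _ _ _ zx zy) => x2 y2 p' q' xx2 yy2 xp' yq'.
      apply: le_trans (ltW tK2).
      apply: (proj_behrstock hD axf M_gt0 KP yx zx zy yz xx1 zz1 xx2 yy2 xp zq xp' yq').
      by rewrite -/K2; lra.
    + move=> X Z; have [x ->] := cosetsP X; have [z ->] := cosetsP Z.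
      apply: (@sub_finite_set _ _ (val @^-1` [set Y | exists g a b,
        [/\ Y = coset g, proj Y x a, proj Y z b & K' < D a b]])); last first.
        by apply: finite_preimage; [move=> ? ? _ _; exact: val_inj|exact: K'P].
      move=> Y; have [y ->] := cosetsP Y => -[/neq_coset yx /neq_coset yz].
      move=> /(far _ _ _ _ yx yz)[x1 [z1 [p [q [xx1 zz1 xp zq pq]]]]].
      have [p' p'P] := pex y x; have [q' q'P] := pex y z.
      exists y, p', q'; split=> //.
      have := KP _ _ _ _ _ _ yx xx1 (coset_id _ _ x) xp p'P.
      have := KP _ _ _ _ _ _ yz (coset_id _ _ z) zz1 q'P zq.
      by have := dist_triangle hD p p' q; have := dist_triangle hD p' q' q; lra.
  + by move=> X; have [x ->] := cosetsP X; rewrite coset_actE mul1g.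
  + by move=> g h X; have [x ->] := cosetsP X; rewrite !coset_actE mulgA.
  + by move=> g Y X Z; exact: proj_diam_mul.
- rewrite coset_actE mulg1; apply/mk_coset_eq; apply: coset_sym.
  by have := coset_mulr 1%g (stab_zpow f M 1); rewrite mul1g.
- move=> X Z n; have [x ->] := cosetsP X; have [z ->] := cosetsP Z.
  rewrite ![_ == mk_coset 1%g]eq_sym => /neq_coset yx /neq_coset yz.
  have [p pP] := pex 1%g x; have [q qP] := pex 1%g z.
  exists (n + (Num.truncn (D 1%g p + D 1%g q)).+1)%N => m nm.
  rewrite coset_actE.
  have f1 : coset (f ^+ m)%g 1%g.
    by apply: coset_sym; have := coset_mulr 1%g (stab_zpow f M m%:Z); rewrite mul1g.
  have yz' : ~ coset 1%g (f ^+ m * z)%g.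
    by move=> /(coset_trans f1); rewrite -{1}[(f ^+ m)%g]mulg1 coset_mul.
  have qP' : proj (coset 1%g) (f ^+ m * z)%g (f ^+ m * q)%g.
    by rewrite -(coset_eq f1) -{1}[(f ^+ m)%g]mulg1 -coset_image; apply/proj_mul.
  have /(dP _ _ _ yx yz')/(_ x _ _ _ (coset_id _ _ x) (coset_id _ _ _) pP qP') :=
    leqnn (coset_diam (mk_coset 1%g) (mk_coset x) (mk_coset (f ^+ m * z)%g)).
  move=> dle; rewrite -(ler_nat R); apply: le_trans dle.
  have := dist_fz_ge axf m; have := truncnS_gt (D 1%g p + D 1%g q).
  have : (n + (Num.truncn (D 1%g p + D 1%g q)).+1)%:R <= m%:R :> R by rewrite ler_nat.
  rewrite natrD; have := dist_triangle hD 1%g p (f ^+ m)%g.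
  have := dist_triangle hD p (f ^+ m * q)%g (f ^+ m * 1)%g.
  rewrite (dist_inv hD) mulg1 (dist_sym hD q) /zpow; lra.
- apply/eqP; rewrite coset_actE mulg1 => /mk_coset_eq/coset_sym.
  by rewrite /coset /= invg1 mul1g.
Qed.

End CosetSystem.

(** * The four point inequality and loxodromic elements *)

Section FourPoint.
Variables (R : realType) (X : metricType R).
Local Open Scope ring_scope.

Lemma geodesic_between x y (a : R -> X) q : geodesic_path x y a ->
  (a @` `[0, mdist x y]) q -> mdist x y = mdist x q + mdist q y.
Proof.
move=> [a0 a1 adist] [t tI <-].
have /andP[t0 t1] : 0 <= t <= mdist x y by move: tI; rewrite /= in_itv.
have I0 : (0 : R) \in `[0, mdist x y] by rewrite in_itv /= lexx mdist_ge0.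
have I1 : mdist x y \in `[0, mdist x y] by rewrite in_itv /= lexx mdist_ge0.
have := adist _ _ I0 tI; have := adist _ _ tI I1; rewrite a0 a1 => -> ->.
by rewrite sub0r normrN ger0_norm// ler0_norm ?subr_le0//; lra.
Qed.

Lemma gromov_product_le_geodesic p x y (a : R -> X) q : geodesic_path x y a ->
  (a @` `[0, mdist x y]) q -> gromov_product p x y <= mdist p q.
Proof.
move=> ga aq; have xy := geodesic_between ga aq.
have := metric_triangle p q x; have := metric_triangle p q y.
by rewrite /gromov_product xy (metric_sym q x); lra.
Qed.

Lemma gromov_productC (p x y : X) : gromov_product p x y = gromov_product p y x.
Proof. by rewrite /gromov_product (metric_sym x y) [mdist p x + _]addrC. Qed.

Section Slim.
Variable delta : R.
Hypothesis delta0 : 0 <= delta.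
Hypothesis geo : geodesic_space X.
Hypothesis slim : slim_triangles X delta.

(** By slimness every point of the side is close to one of the two others. On a subdivision of mesh
    at most 1, two neighbours (or one end) are close to different sides; the mesh accounts for the
    summand 1. *)
Lemma geodesic_near_product p x z (a : R -> X) : geodesic_path x z a ->
  exists2 q, (a @` `[0, mdist x z]) q &
    mdist p q <= gromov_product p x z + 2 * delta + 1.
Proof.
move=> ga; have [b gb] := geo z p; have [e ge] := geo p x.
have [a0 a1 adist] := ga.
set l := mdist x z in a1 adist *; have l0 : 0 <= l := mdist_ge0 x z.
pose near_zp t := exists2 r, (b @` `[0, mdist z p]) r & mdist (a t) r <= delta.
pose near_px t := exists2 r, (e @` `[0, mdist p x]) r & mdist (a t) r <= delta.
have cover t : t \in `[0, l] -> near_zp t \/ near_px t.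
  move=> tl; have [|q [bq|eq] dq] := slim ga gb ge (p := a t); first by exists t.
    by left; exists q.
  by right; exists q.
pose n := (Num.truncn l).+1.
have n0 : 0 < n%:R :> R by rewrite ltr0n.
pose t i := l * i%:R / n%:R.
have tI i : (i <= n)%N -> t i \in `[0, l].
  move=> i_n; rewrite in_itv /=; apply/andP; split.
    by rewrite divr_ge0 ?mulr_ge0.
  by rewrite ler_pdivrMr// ler_wpM2l// ler_nat.
have tn : t n = l by rewrite /t mulfK// gt_eqF.
have t0 : t 0%N = 0 by rewrite /t mulr0 mul0r.
have [u [v [uI vI uv pu zv]]] : exists u v, [/\ u \in `[0, l], v \in `[0, l],
    `|u - v| <= 1, near_px u & near_zp v].
  have end_zp : `[< near_zp (t n) >].
    apply/asboolP; rewrite tn /near_zp a1; exists z; last by rewrite mdistxx.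
    by case: gb => b0 _ _; exists 0 => //; rewrite /= in_itv /= lexx mdist_ge0.
  have /ex_minnP[i /asboolP zi imin] : exists i, `[< near_zp (t i) >] by exists n.
  have i_n := imin _ end_zp; case: i => [|i] in zi imin i_n *.
    have I0 : (0 : R) \in `[0, l] by have := tI _ (leq0n n); rewrite t0.
    exists 0, 0; rewrite subrr normr0; split=> //; last by rewrite -t0.
    rewrite /near_px a0; exists x; last by rewrite mdistxx.
    by case: ge => _ e1 _; exists (mdist p x) => //; rewrite /= in_itv /= lexx mdist_ge0.
  exists (t i), (t i.+1); split=> //.
  - exact/tI/ltnW.
  - exact: tI.
  - rewrite /t -natr1 mulrDr mulr1 mulrDl opprD addrA subrr sub0r normrN ger0_norm ?divr_ge0//.
    by rewrite ler_pdivrMr// mul1r ltW// truncnS_gt.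
  have [|/asboolP zi'|//] := cover (t i); first by apply: tI; exact: ltnW.
  by have := imin _ zi'; rewrite ltnn.
exists (a u); first by exists u.
have [r er dr] := pu; have [r' br' dr'] := zv.
have h1 := geodesic_between ge er; have h2 := geodesic_between gb br'.
have h3 : mdist (a u) r' <= delta + 1.
  by have := metric_triangle (a u) (a v) r'; rewrite adist//; lra.
have h4 : mdist x z <= mdist x r + mdist r (a u) + mdist (a u) r' + mdist r' z.
  have := metric_triangle x r z; have := metric_triangle r (a u) z.
  by have := metric_triangle (a u) r' z; lra.
have h5 := metric_triangle p r (a u); have h6 := metric_triangle p r' (a u).
rewrite /gromov_product h1; move: h2 h3 h4 h5 h6 dr.
rewrite (metric_sym z p) (metric_sym z r') (metric_sym r' p) (metric_sym x r).
rewrite (metric_sym r (a u)) (metric_sym r' (a u)); lra.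
Qed.

(** A point of the side from [x] to [z] realises the product up to [2 * delta + 1]; slimness moves
    it to another side for one more [delta], and there the distance to [p] bounds the product of
    that side. *)
Lemma four_point (p x y z : X) t : t <= gromov_product p x y -> t <= gromov_product p y z ->
  t - (3 * delta + 1) <= gromov_product p x z.
Proof.
move=> txy tyz; have [a ga] := geo x z; have [b gb] := geo z y; have [e ge] := geo y x.
have [q aq pq] := geodesic_near_product p ga.
have [r br qr] := slim ga gb ge aq.
have pr : mdist p r <= gromov_product p x z + 3 * delta + 1.
  by have := metric_triangle p q r; lra.
case: br => [br|er].
  by have := gromov_product_le_geodesic p gb br; rewrite gromov_productC; lra.
by have := gromov_product_le_geodesic p ge er; rewrite gromov_productC; lra.
Qed.

End Slim.
End FourPoint.

(** * A local criterion for loxodromic elements *)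

Section Powers.
Variables (R : realType) (G : groupType) (D : G -> G -> R) (delta : R).
Local Open Scope ring_scope.
Hypothesis hD : hyperbolic_distance D delta.
Local Notation gp := (gp D).

(** A step of [f] exceeds twice the backtracking at [1]. The multiple of [delta] absorbs
    hyperbolicity errors, and the summand 1 becomes the growth rate in [axis_proper]. *)
Definition quasi_straight (f : G) := 2 * gp 1%g f f^-1%g + 3 * delta + 1 < D 1%g f.

Lemma quasi_straightV f : quasi_straight f -> quasi_straight f^-1%g.
Proof. by rewrite /quasi_straight (dist1V hD) invgK (gpC hD 1%g f^-1%g). Qed.

Lemma quasi_straight_powers f n : quasi_straight f ->
  gp (f ^+ n.+1)%g 1%g (f ^+ n.+2)%g <= gp 1%g f f^-1%g + delta /\
  n.+1%:R <= D 1%g (f ^+ n.+1)%g.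
Proof.
set K := gp 1%g f f^-1%g => fs; have d0 := dist_delta hD.
have K0 : 0 <= K := gp_ge0 hD _ _ _.
have stepD i : D (f ^+ i)%g (f ^+ i.+1)%g = D 1%g f.
  by rewrite expgSr -[X in D X _]mulg1 (dist_inv hD).
have gpS i : gp (f ^+ i.+1)%g (f ^+ i)%g (f ^+ i.+2)%g = K.
  have e1 : ((f ^+ i.+1)^-1 * f ^+ i = f^-1)%g by rewrite expgSr invgM mulgVK.
  have e2 : ((f ^+ i.+1)^-1 * f ^+ i.+2 = f)%g by rewrite (expgSr f i.+1) mulKg.
  by rewrite -(gp_inv hD (f ^+ i.+1)^-1%g) mulVg e1 e2 (gpC hD).
elim: n => [|n [IH1 IH2]].
  split; first by have := gpS 0%N; rewrite expg0; lra.
  by rewrite expg1; move: fs; rewrite /quasi_straight -/K; lra.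
have near : K + delta < gp (f ^+ n.+2)%g (f ^+ n.+1)%g 1%g.
  have := gp_split hD (f ^+ n.+2)%g (f ^+ n.+1)%g 1%g.
  rewrite (dist_sym hD _ (f ^+ n.+1)%g) stepD [gp (f ^+ n.+1)%g _ _](gpC hD).
  by move: fs; rewrite /quasi_straight -/K; lra.
split; first by apply: (gp_lt hD near); rewrite gpS.
have := IH1; rewrite gpE stepD (dist_sym hD _ 1%g) -[n.+2%:R]natr1.
by move: fs; rewrite /quasi_straight -/K; lra.
Qed.

(** The product of [f^-p] and [f^q] at [1] is compared with that of [f^-p] and [f], then with that
    of [f^-1] and [f]; each replacement of a power by its first step costs [delta]. *)
Lemma quasi_straight_axis f : quasi_straight f ->
  is_axis D f (gp 1%g f f^-1%g + 2 * delta).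
Proof.
move=> fs; have fVs := quasi_straightV fs; have d0 := dist_delta hD.
set K := gp 1%g f f^-1%g; have K0 : 0 <= K := gp_ge0 hD _ _ _.
have KV : gp 1%g f^-1%g (f^-1)^-1%g = K by rewrite invgK (gpC hD).
have one_sided g n : quasi_straight g -> gp 1%g (g ^- n.+1)%g g <= gp 1%g g g^-1%g + delta.
  move=> /(quasi_straight_powers n)[+ _]; rewrite -(gp_inv hD (g ^+ n.+1)^-1%g).
  by rewrite mulVg mulg1 (expgSr g n.+1) mulKg.
have posr n : gp 1%g (f ^- n.+1)%g f <= K + delta by exact: one_sided.
have negr n : gp 1%g (f ^+ n.+1)%g f^-1%g <= K + delta.
  by have := one_sided _ n fVs; rewrite KV expVgn invgK.
have two_sided p q : gp 1%g (f ^- p)%g (f ^+ q)%g <= K + 2 * delta.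
  case: p => [|p].
    by rewrite expg0 invg1; have := gp_lel hD 1%g 1%g (f ^+ q)%g; rewrite (dist_id hD); lra.
  case: q => [|q].
    by rewrite expg0; have := gp_ler hD 1%g (f ^- p.+1)%g 1%g; rewrite (dist_id hD); lra.
  have far : K + delta + delta < gp 1%g f (f ^+ q.+1)%g.
    move: fs; rewrite /quasi_straight -/K => fs; case: q => [|q].
      by rewrite expg1 gpE (dist_id hD); lra.
    have := gp_split hD 1%g f (f ^+ q.+2)%g.
    have -> : gp f 1%g (f ^+ q.+2)%g = gp 1%g (f ^+ q.+1)%g f^-1%g.
      by rewrite -(gp_inv hD f^-1%g) mulVg mulg1 (expgS f q.+1) mulKg (gpC hD).
    by have := negr q; lra.
  have := posr p; rewrite (gpC hD) => /(gp_lt hD far); rewrite (gpC hD); lra.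
split=> [i j k /andP[ij jk]|n].
  rewrite -(gp_inv hD (zpow f j)^-1%g) mulVg -zpowN -!zpowD.
  have -> : - j + i = - (`|j - i|%N)%:Z by lia.
  have -> : - j + k = (`|k - j|%N)%:Z by lia.
  by rewrite zpowN; exact: two_sided.
have lenN m : m%:R <= D 1%g (f ^+ m)%g.
  case: m => [|m]; first by rewrite expg0 (dist_id hD).
  by have [] := quasi_straight_powers m fs.
case: n => n; first exact: lenN.
by rewrite NegzE normrN zpowN (dist1V hD); exact: lenN.
Qed.

(* If neither [g] nor [h] is quasi-straight, then [g^-1 p] follows [g p] and
   [h^-1 p] follows [h p] for a long time, so that [g h] is quasi-straight. *)
Lemma quasi_straight_exists (g h : G) K : gp 1%g g h <= K ->
    4 * K + 14 * delta + 2 < D 1%g g -> 4 * K + 14 * delta + 2 < D 1%g h ->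
  exists f, quasi_straight f.
Proof.
move=> gh gl hl; have d0 := dist_delta hD.
have K0 : 0 <= K by apply: le_trans gh; exact: gp_ge0 hD _ _ _.
have [gs|gs] := ltP (2 * gp 1%g g g^-1%g + 3 * delta + 1) (D 1%g g); first by exists g.
have [hs|hs] := ltP (2 * gp 1%g h h^-1%g + 3 * delta + 1) (D 1%g h); first by exists h.
have gVh : gp 1%g g^-1%g h <= K + delta by apply: (gp_lt hD _ gh); lra.
have hVg : gp 1%g h^-1%g g <= K + delta.
  by rewrite (gpC hD) in gh; apply: (gp_lt hD _ gh); lra.
exists (g * h)%g; rewrite /quasi_straight.
have len : D 1%g (g * h)%g = D 1%g g + D 1%g h - 2 * gp 1%g g^-1%g h.
  rewrite gpE (dist1V hD) -(dist_inv hD g^-1%g 1%g) mulg1 mulKg; lra.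
have g_gh : D 1%g g - (K + delta) <= gp 1%g g (g * h)%g.
  have := gp_split hD 1%g g (g * h)%g.
  by rewrite -(gp_inv hD g^-1%g g) mulVg mulg1 mulKg; lra.
have hV_ghV : D 1%g h - (K + delta) <= gp 1%g h^-1%g (g * h)^-1%g.
  have := gp_split hD 1%g h^-1%g (g * h)^-1%g.
  rewrite -(gp_inv hD h h^-1%g) mulgV mulg1 invgM mulVKg (dist1V hD) (gpC hD 1%g h).
  lra.
have c1 : gp 1%g (g * h)%g h^-1%g <= K + delta + delta.
  by rewrite (gpC hD) in hVg; apply: (gp_lt hD _ hVg); lra.
have c2 : gp 1%g (g * h)^-1%g (g * h)%g <= K + delta + delta + delta.
  by rewrite (gpC hD) in c1; apply: (gp_lt hD _ c1); lra.
by rewrite (gpC hD) len; lra.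
Qed.

End Powers.

(** * Limit sets *)

Section LimitSet.
Variables (R : realType) (G : groupType) (X : metricType R).
Variables (act : G -> X -> X) (p : X) (delta : R).
Local Open Scope ring_scope.

Hypothesis isom : isometric_action act.
Hypothesis delta0 : 0 <= delta.
Hypothesis hyp4 : forall (a x y z : X) t, t <= gromov_product a x y ->
  t <= gromov_product a y z -> t - delta <= gromov_product a x z.

Lemma gromov_asymptoticP (u v : nat -> X) : gromov_asymptotic p u v <->
  forall K, exists N, forall i j, (N <= i)%N -> (N <= j)%N ->
    K <= gromov_product p (u i) (v j).
Proof.
split=> [/cvgryPge uv K|uv].
  have [[A B] [/= [N1 _ A1] [N2 _ B2]] AB] := uv K.
  exists (maxn N1 N2) => i j; rewrite !geq_max => /andP[i1 _] /andP[_ j2].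
  by apply: (AB (i, j)); split; [exact: A1|exact: B2].
apply/cvgryPge => K; have [N NP] := uv K.
exists ([set n | (N <= n)%N], [set n | (N <= n)%N]); first by split; exists N.
by move=> [i j] /= [Ni Nj]; exact: NP.
Qed.

Lemma gromov_asymptotic_sym u v : gromov_asymptotic p u v -> gromov_asymptotic p v u.
Proof.
move=> /gromov_asymptoticP uv; apply/gromov_asymptoticP => K; have [N NP] := uv K.
by exists N => i j Ni Nj; rewrite gromov_productC NP.
Qed.

Lemma gromov_asymptotic_trans u v w : gromov_asymptotic p u v ->
  gromov_asymptotic p v w -> gromov_asymptotic p u w.
Proof.
move=> /gromov_asymptoticP uv /gromov_asymptoticP vw; apply/gromov_asymptoticP => K.
have [N1 N1P] := uv (K + delta); have [N2 N2P] := vw (K + delta).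
exists (maxn N1 N2) => i j; rewrite !geq_max => /andP[i1 i2] /andP[j1 j2].
have := hyp4 (N1P _ _ i1 (leq_maxl N1 N2)) (N2P _ _ (leq_maxr N1 N2) j2); lra.
Qed.

Lemma boundary_point_eq u v : gromov_asymptotic p u v ->
  boundary_point p u = boundary_point p v.
Proof.
move=> uv; apply/seteqP; split=> w [w1 w2]; split=> //.
  by apply: gromov_asymptotic_trans w2; exact: gromov_asymptotic_sym.
exact: gromov_asymptotic_trans w2.
Qed.

Definition orbit_dist (g h : G) : R := mdist (act g p) (act h p).

Lemma orbit_dist_hyperbolic : hyperbolic_distance orbit_dist delta.
Proof.
have [act1 actM actD] := isom; split => //.
- by move=> x; exact: mdistxx.
- by move=> x y; exact: metric_sym.
- by move=> x y z; exact: metric_triangle.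
- by move=> k x y; rewrite /orbit_dist !actM actD.
- by move=> a x y z t; exact: hyp4.
Qed.

Local Notation D := orbit_dist.
Let hD := orbit_dist_hyperbolic.

Lemma gp_orbit g h : gp D 1%g g h = gromov_product p (act g p) (act h p).
Proof. by have [act1 _ _] := isom; rewrite /gp /orbit_dist act1. Qed.

Lemma limit_setP xi : limit_set act p xi -> exists g : nat -> G,
  [/\ converges_at_infinity p (fun n => act (g n) p) &
      xi = boundary_point p (fun n => act (g n) p)].
Proof.
move=> [[u uc <-] [g [gc ug]]]; exists g; split=> //.
exact: boundary_point_eq.
Qed.

Lemma limit_set_avoid (S : set (set (nat -> X))) a b : ~ (S #<= `I_2)%card ->
  exists2 x, S x & x <> a /\ x <> b.
Proof.
move=> S2; apply: contrapT => none; apply: S2.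
pose e n := if n is 0%N then a else b.
apply: card_le_trans (card_image_le e `I_2); apply: subset_card_le => x Sx.
have [->|xa] := pselect (x = a); first by exists 0%N.
have [->|xb] := pselect (x = b); first by exists 1%N.
by exfalso; apply: none; exists x.
Qed.

Hypothesis many : ~ (limit_set act p #<= `I_2)%card.

Lemma orbit_quasi_straight : exists f, quasi_straight D delta f.
Proof.
have d0 := delta0.
have [xi1 /limit_setP[g [gc ->]] _] := limit_set_avoid set0 set0 many.
have [xi2 /limit_setP[h [hc ->]] [gh _]] :=
  limit_set_avoid (boundary_point p (fun n => act (g n) p)) set0 many.
have /gromov_asymptoticP : ~ gromov_asymptotic p (fun n => act (g n) p) (fun n => act (h n) p).
  by move=> /boundary_point_eq gh'; apply: gh.
move=> /existsNP[K /forallNP far].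
move: gc hc => /gromov_asymptoticP gc /gromov_asymptoticP hc.
(* Failure to be asymptotic yields only some far indices with product at most [K]; exchanging both
   for [N] costs [delta] each. [B] is the length that [quasi_straight_exists] demands. *)
pose K2 := K + 2 * delta; pose B := 4 * K2 + 14 * delta + 2.
have [N1 N1P] := gc (Num.max (K2 + 1) (B + 1)).
have [N2 N2P] := hc (Num.max (K2 + 1) (B + 1)).
pose N := maxn N1 N2.
have {}N1P i j : (N <= i)%N -> (N <= j)%N ->
    K2 < gp D 1%g (g i) (g j) /\ B < gp D 1%g (g i) (g j).
  rewrite !geq_max => /andP[i1 _] /andP[j1 _]; have := N1P i j i1 j1.
  by rewrite gp_orbit ge_max /= => /andP[? ?]; split; lra.
have {}N2P i j : (N <= i)%N -> (N <= j)%N ->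
    K2 < gp D 1%g (h i) (h j) /\ B < gp D 1%g (h i) (h j).
  rewrite !geq_max => /andP[_ i2] /andP[_ j2]; have := N2P i j i2 j2.
  by rewrite gp_orbit ge_max /= => /andP[? ?]; split; lra.
have [i0 [j0 [Ni0 Nj0 ij0]]] : exists i0 j0, [/\ (N <= i0)%N, (N <= j0)%N &
    gp D 1%g (g i0) (h j0) <= K].
  apply: contrapT => none; apply: (far N) => i j Ni Nj; rewrite -gp_orbit leNgt.
  by apply/negP => ij; apply: none; exists i, j; split=> //; exact: ltW.
apply: (quasi_straight_exists hD (g := g N) (h := h N) (K := K2)).
- have [gK _] := N1P i0 N Ni0 (leqnn N); have [hK _] := N2P j0 N Nj0 (leqnn N).
  have h1 : gp D 1%g (g N) (h j0) <= K + delta.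
    by apply: (gp_lt hD _ ij0); apply: le_lt_trans gK; rewrite /K2; lra.
  rewrite (gpC hD) in h1; rewrite (gpC hD); have : gp D 1%g (h N) (g N) <= K + delta + delta.
    by apply: (gp_lt hD _ h1); apply: le_lt_trans hK; rewrite /K2; lra.
  by rewrite /K2; lra.
- have [_] := N1P N N (leqnn N) (leqnn N); rewrite -/B => /lt_le_trans; apply.
  exact: gp_lel hD _ _ _.
- have [_] := N2P N N (leqnn N) (leqnn N); rewrite -/B => /lt_le_trans; apply.
  exact: gp_lel hD _ _ _.
Qed.

(* If the whole group stays close to the axis of [f], then only the two ends of
   the axis are limit points. *)
Lemma orbit_off_axis f c C : is_axis D f c -> exists b, forall j, C < D b (zpow f j).
Proof.
move=> axf; apply: contrapT => none.
have close g : exists j, D g (zpow f j) <= C.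
  apply: contrapT => far; apply: none; exists g => j; rewrite ltNge; apply/negP => gj.
  by apply: far; exists j.
pose ray e := boundary_point p (fun n => act (zpow f (sg e n)) p).
have [xi /limit_setP[g [gc ->]] []] := limit_set_avoid (ray false) (ray true) many.
suff [e ->] : exists e, boundary_point p (fun n => act (g n) p) = ray e by case: e.
move/gromov_asymptoticP in gc.
have /boolp.choice[m mP] : forall n, exists j, D (g n) (zpow f j) <= C by move=> n.
(* Passing to the nearby powers costs [2 * C]; the rest exceeds [c], which excludes exponents of
   opposite signs, so the sequence follows a single end of the axis. *)
have [N NP] := gc (c + 2 * C + 1).
have same i : (N <= i)%N -> c < gp D 1%g (zpow f (m N)) (zpow f (m i)).
  move=> Ni; have := NP N i (leqnn N) Ni; rewrite -gp_orbit.
  have := gp_lipl hD 1%g (g N) (zpow f (m N)) (g i).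
  have := gp_lipr hD 1%g (zpow f (m N)) (g i) (zpow f (m i)).
  by have := mP N; have := mP i; lra.
have line i j : (i <= 0)%R -> (0 <= j)%R -> gp D 1%g (zpow f i) (zpow f j) <= c.
  by move=> i0 j0; have := axis_line axf (i := i) (j := 0) (k := j); rewrite i0 j0; apply.
have [e mE] : exists e, forall i, (N <= i)%N -> m i = sg e `|m i|%N.
  have [mN|mN] := leP 0 (m N); [exists false|exists true] => i Ni; rewrite /sg.
    have [mi|mi] := leP 0 (m i); first by lia.
    by have := same i Ni; rewrite (gpC hD) ltNge line//; exact: ltW.
  have [mi|mi] := leP (m i) 0; first by lia.
  by have := same i Ni; rewrite ltNge line//; exact: ltW.
exists e; apply/esym/boundary_point_eq/gromov_asymptoticP => K.
have [N' N'P] := gc (K + c + 2 * C).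
pose B := (Num.truncn (K + c + 2 * C)).+1.
exists (maxn B (maxn N N')) => i j; rewrite !geq_max => /and3P[Bi _ _] /and3P[_ Nj N'j].
rewrite -gp_orbit.
have lj : K + c + 2 * C <= D 1%g (g j).
  by apply: le_trans (N'P j j N'j N'j) _; rewrite -gp_orbit; exact: gp_lel hD _ _ _.
have Bl : K + c + 2 * C < B%:R := truncnS_gt _.
have C0 : 0 <= C by apply: le_trans (mP 0%N); exact: dist_ge0 hD _ _.
have c0 : 0 <= c by exact: axis_c hD axf.
have li : i%:R <= D 1%g (zpow f (sg e i)) by rewrite (dist_sg _ hD) (dist_fz_ge axf).
have Bi' : B%:R <= i%:R :> R by rewrite ler_nat.
have := mP j; rewrite (mE j Nj); set r := `|m j|%N => gj.
have := gp_lipr hD 1%g (zpow f (sg e i)) (zpow f (sg e r)) (g j).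
rewrite (dist_sym hD _ (g j)) => lip.
have lr : D 1%g (g j) <= D 1%g (zpow f (sg e r)) + C.
  have := dist_triangle hD 1%g (zpow f (sg e r)) (g j).
  by rewrite (dist_sym hD (zpow _ _) (g j)); lra.
have sg0 : zpow f (0 + sg e 0) = 1%g by case: (e).
have [ir|/ltnW ri] := leqP i r.
  have := ray_line hD axf 1%g 0 e ir; rewrite !mul1g sg0 !add0r => line1.
  by have := gp_split hD 1%g (zpow f (sg e i)) (zpow f (sg e r)); lra.
have := ray_line hD axf 1%g 0 e ri; rewrite !mul1g sg0 !add0r => line1.
have := gp_split hD 1%g (zpow f (sg e r)) (zpow f (sg e i)).
by rewrite (gpC hD 1%g (zpow f (sg e r))); lra.
Qed.

Lemma acylindrical_list : acylindrical act -> forall E : R, exists (L : R) (N : nat),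
  forall y, L < D 1%g y -> exists l : seq G, (size l <= N)%N /\
    forall g, D 1%g g < E -> D y (g * y)%g < E -> g \in l.
Proof.
have [act1 actM actD] := isom.
move=> acyl E; have E1 : 0 < Num.max E 1 by rewrite lt_max ltr01 orbT.
have [L [N [_ _ LN]]] := acyl _ E1; exists L, N => y; rewrite /D act1 => Ly.
have [n nN card_n] := LN _ _ Ly.
set S := (X in (X #= _)%card) in card_n.
exists (finmap.enum_fset (fset_set S)); split.
  by have -> := card_fset_set card_n; exact: ltnW.
move=> g g1 g2; have finS : finite_set S by apply/finite_setP; exists n.
suff : g \in S by rewrite -(in_fset_set finS g).
apply/mem_set; split; rewrite lt_max; apply/orP; left.
  exact: g1.
by rewrite -actM.
Qed.

End LimitSet.

Theorem theorem1p1 (R : realType) (G : groupType) (k : nat)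
    (w : free_group k) :
  acylindrically_hyperbolic R G ->
  (1 <= k)%N ->
  w <> 1%g ->
  exponent_gcd w <> 1%N ->
  verbal_width G R w = +oo%E.
Proof.
move=> [X [act [isom [geo [delta delta0 slim]] acyl [p many]]]] _ w1 ew1.
pose delta' : R := (3 * delta + 1)%R.
have delta'0 : (0 <= delta')%R by rewrite /delta'; lra.
have hyp4 : forall (a x y z : X) t, (t <= gromov_product a x y)%R ->
    (t <= gromov_product a y z)%R -> (t - delta' <= gromov_product a x z)%R.
  by move=> a x y z t; exact: four_point.
have hD := orbit_dist_hyperbolic p isom delta'0 hyp4.
have acylD := acylindrical_list p isom acyl.
have [f fs] := orbit_quasi_straight isom delta'0 hyp4 many.
have axf := quasi_straight_axis hD fs; set c := (_ + _)%R in axf.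
have [M [M0 fellow]] := axis_stabilizer hD axf acylD.
(* By [stab_close] no element of [stab] is farther than [axis_const] from the axis, so this [b]
   moves the coset of [1]. *)
have [b bfar] := orbit_off_axis isom delta'0 hyp4 many
  (axis_const (orbit_dist act p) delta' f c) axf.
have b_nstab : ~ stab f M b.
  by move=> /(stab_close hD axf M0)[j]; rewrite leNgt bfar.
have [theta sys] := coset_loxodromic hD axf M0 fellow acylD b_nstab.
apply/eqyP => A _.
have [g [wg gn]] := verbal_product_unbounded sys w1 ew1 (Num.truncn A).
(* Since [g] lies in the verbal subgroup, its length is a true minimum and not the default 0. *)
have glen : (Num.truncn A < verbal_length w g)%N.
  have /ex_minnP[n /asboolP wn nmin] : exists n, `[< verbal_product w g n >].
    by have [n wn] := verbal_productP wg; exists n; apply/asboolP.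
  rewrite /verbal_length; case: xgetP => [m _ [wm _]|none]; first exact: gn.
  by case: (none n); split=> // m wm; apply: nmin; apply/asboolP.
apply: (@le_trans _ _ ((verbal_length w g)%:R%:E)); last by apply: ereal_sup_ubound; exists g.
by rewrite lee_fin; apply: ltW; apply: lt_le_trans (truncnS_gt A) _; rewrite ler_nat.
Qed.
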